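(* Let $k\ge1$, $\ell\ge 4$ be integers, let $t=(\ell^2-\ell+1)k+\frac{\ell^2+3\ell-2}{2}$, and let $n\ge 8\left(k+\lfloor \ell/2\rfloor\right)^3t^8$. (1) If $\ell$ is even, then $\mathrm{Ex}_{sp}(n,\,kS_{\ell-1}\cup P_\ell)=\{S_{n,\,\frac{2k+\ell-2}{2}}\}$. (2) If $\ell$ is odd, then $\mathrm{Ex}_{sp}(n,\,kS_{\ell-1}\cup P_\ell)=\{S^{+}_{n,\,\frac{2k+\ell-3}{2}}\}$.
   Context: $P_n$ is the path of order $n$; $S_{n-1}$ is the star of order $n$ (so $S_{\ell-1}=K_{1,\ell-1}$). $kH$ denotes the vertex-disjoint union of $k$ copies of $H$, $\cup$ vertex-disjoint union. A graph is $F$-free if it has no subgraph isomorphic to $F$. $\mathrm{Ex}_{sp}(n,F)$ is the set of $F$-free graphs of order $n$ with maximum spectral radius (largest adjacency eigenvalue) among all $F$-free graphs of order $n$. $S_{n,h}=K_h\vee\overline{K}_{n-h}$ and $S^{+}_{n,h}=K_h\vee(K_2\cup\overline{K}_{n-h-2})$, where $\vee$ is the join. *)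

(* Defs.v *)
From HB Require Import structures.
From mathcomp Require Import all_boot all_order all_algebra.
From mathcomp Require Import reals.
Set Implicit Arguments. Unset Strict Implicit. Unset Printing Implicit Defensive.
Import Order.TTheory GRing.Theory Num.Theory.
Local Open Scope ring_scope.

Definition simple_graph (T : finType) (e : rel T) : Prop :=
  symmetric e /\ irreflexive e.

Definition contains_graph (V T : finType) (eH : rel V) (eG : rel T) : Prop :=
  exists f : V -> T, injective f /\ forall x y, eH x y -> eG (f x) (f y).

Definition Ffree (V T : finType) (eF : rel V) (eG : rel T) : Prop :=
  ~ contains_graph eF eG.

Definition graph_iso (T : finType) (e1 e2 : rel T) : Prop :=
  exists f : T -> T, bijective f /\ forall x y, e1 x y = e2 (f x) (f y).

Definition adj_mx (R : realType) (n : nat) (e : rel 'I_n) : 'M[R]_n :=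
  \matrix_(i, j) (e i j)%:R.

Definition is_spec_radius (R : realType) (n : nat) (e : rel 'I_n) (r : R) : Prop :=
  eigenvalue (adj_mx R e) r /\
  forall a : R, eigenvalue (adj_mx R e) a -> a <= r.

Definition in_Ex_sp (R : realType) (V : finType) (eF : rel V) (n : nat)
    (e : rel 'I_n) : Prop :=
  simple_graph e /\ Ffree eF e /\
  exists rG : R, is_spec_radius e rG /\
    forall eH : rel 'I_n, simple_graph eH -> Ffree eF eH ->
      forall rH : R, is_spec_radius eH rH -> rH <= rG.

Definition path_rel (l : nat) : rel 'I_l :=
  fun x y => (x.+1 == y :> nat) || (y.+1 == x :> nat).

(* The star S_{l-1} = K_{1,l-1} on vertices 0..l-1 with centre 0. *)
Definition star_rel (l : nat) : rel 'I_l :=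
  fun x y => (x != y) && ((x == 0 :> nat) || (y == 0 :> nat)).

Definition kstar_path_type (k l : nat) : finType := (('I_k * 'I_l) + 'I_l)%type.

Definition kstar_path (k l : nat) : rel (kstar_path_type k l) :=
  fun u v => match u, v with
  | inl (i, x), inl (j, y) => (i == j) && star_rel x y
  | inr x, inr y => path_rel x y
  | _, _ => false
  end.

(* S_{n,h} = K_h \join \bar K_{n-h}; vertices 0..h-1 form the K_h. *)
Definition S_nh (n h : nat) : rel 'I_n :=
  fun x y => (x != y) && ((x < h)%N || (y < h)%N).

Arguments S_nh : clear implicits.

(* S^+_{n,h} = K_h \join (K_2 \cup \bar K_{n-h-2}); the K_2 is {h, h+1}. *)
Definition S_nh_plus (n h : nat) : rel 'I_n :=
  fun x y => S_nh n h x y ||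
    ((x == h :> nat) && (y == h.+1 :> nat)) || ((x == h.+1 :> nat) && (y == h :> nat)).

Arguments S_nh_plus : clear implicits.
Arguments kstar_path : clear implicits.
Arguments in_Ex_sp R {V} eF {n} e.

(* Main.v *)
(* Let h = k + floor(l/2) - 1 and s = 2 if l is odd, 0 otherwise; the extremal graph joins a
   clique L on h vertices to an independent set with, for odd l, one edge P inside it.
   Its Perron vector z is explicit, with eigenvalue rho >= sqrt(h n).

   Let e be F-free with an eigenvalue r >= rho.  The absolute values of an eigenvector give
   0 <= x <= 1 with maximum 1 and r x <= A x.  Greedy embedding shows that F-free graphs are
   sparse: e(A,B) <= h|A| + N|B| for disjoint A, B and N = (k+1) l.  Applied to the level
   sets of x and of min(1, 2x), this bounds the number of weighted walks of length two,
   while r^2 >= h n bounds it from below; as a result every entry of x is either near 1 or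
   near 0, and exactly h entries are near 1, at vertices of degree near n.  Let L be this
   set, and E the few vertices outside L not adjacent to all of L.  By F-freeness
   the edges avoiding L are, except for one pair P when l is odd, essentially inside E.

   Finally r >= rho forces z^T (A_J - A_e) x <= 0 for the target graph J on (L, P).  Each
   vertex of E misses an edge to L, which outweighs the O(N|E|) extra edges, as
   these only see small entries of x.  Hence E is empty and e is contained in J, and a
   missing edge of J would force x to vanish at a vertex adjacent to L. *)
Require Import Defs.
From HB Require Import structures.
From mathcomp Require Import all_boot all_order all_algebra.
From mathcomp Require Import reals.
From mathcomp Require Import zify ring lra.
Set Implicit Arguments. Unset Strict Implicit. Unset Printing Implicit Defensive.
Import Order.TTheory GRing.Theory Num.Theory.

(** * Greedy embeddings and sparsity *)

Definition nbr (T : finType) (e : rel T) (x : T) : {set T} := [set y | e x y].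

Lemma exists_subset_card (T : finType) (A : {set T}) (m : nat) :
  m <= #|A| -> exists2 B : {set T}, B \subset A & #|B| = m.
Proof.
move=> /card_geqP [s [us <- sA]]; exists [set x in s].
  by apply/subsetP => x; rewrite inE => /sA.
by rewrite cardsE; apply/card_uniqP.
Qed.

Lemma leq_card_bigcup (I T : finType) (P : pred I) (S : I -> {set T}) :
  #|\bigcup_(i | P i) S i| <= \sum_(i | P i) #|S i|.
Proof.
elim/big_rec2: _ => [|i m U _ le_Um]; first by rewrite cards0.
by rewrite (leq_trans (leq_card_setU _ _)) // leq_add2l.
Qed.

(** Greedy choice: when the set numbered [j] is picked, [A] and the earlier sets occupy at most
    [#|A| + j * m] vertices, so the degree bound still leaves [m] free neighbours. *)
Lemma exists_leaf_sets (T : finType) (e : rel T) (A : {set T}) (c : nat -> T) (m j : nat) :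
  (forall i, i < j -> #|A| + j * m <= #|nbr e (c i)|) ->
  exists S : nat -> {set T},
    (forall i, i < j -> [/\ S i \subset nbr e (c i), [disjoint S i & A] & #|S i| = m]) /\
    (forall i i', i < j -> i' < j -> i != i' -> [disjoint S i & S i']).
Proof.
elim: j => [|j IHj] degc; first by exists (fun=> set0).
have [i lt_ij|S [propS disS]] := IHj.
  by apply: leq_trans (degc i (ltnW lt_ij)); rewrite leq_add2l mulSn leq_addl.
pose U := A :|: \bigcup_(i < j) S i.
have cardU : #|U| <= #|A| + j * m.
  rewrite (leq_trans (leq_card_setU _ _)) // leq_add2l.
  rewrite (leq_trans (leq_card_bigcup _ _)) //.
  rewrite (eq_bigr (fun=> m)); first by rewrite sum_nat_const card_ord.
  by move=> i _; case: (propS i (ltn_ord i)).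
have [|B sB cardB] := @exists_subset_card T (nbr e (c j) :\: U) m.
  have := degc j (ltnSn j); have := cardsID U (nbr e (c j)).
  have := subset_leq_card (subsetIr (nbr e (c j)) U); rewrite mulSn; lia.
have disB : [disjoint B & U].
  by move: sB; rewrite subsetD => /andP[].
have disBS i : i < j -> [disjoint B & S i].
  move=> ij; apply: disjointWr disB; rewrite subsetU //; apply/orP; right.
  exact: (bigcup_sup (Ordinal ij)).
exists (fun i => if i == j then B else S i); split=> [i|i i'].
  rewrite ltnS leq_eqVlt; case: eqP => [-> _|_ /= /propS //].
  split=> //; first by move: sB; rewrite subsetD => /andP[].
  by apply: disjointWr disB; rewrite subsetUl.
rewrite !ltnS (leq_eqVlt i) (leq_eqVlt i').
case: (eqVneq i j) => [->|_] /=; case: (eqVneq i' j) => [->|_] //=.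
- by move=> _ ij _; apply: disBS.
- by move=> ij _ _; rewrite disjoint_sym disBS.
- exact: disS.
Qed.


(** Reduces every embedding to a path and [k] star centres. Path, centres and leaves number
    [l + k + k * (l - 1) = k.+1 * l] in all, so centres of that degree let the leaves be found
    greedily. *)
Lemma contains_kstar_path (T : finType) (e : rel T) (k l : nat) (p c : seq T) :
  symmetric e -> 0 < l -> uniq (p ++ c) -> size p = l -> size c = k -> sorted e p ->
  {in c, forall x, k.+1 * l <= #|nbr e x|} ->
  contains_graph (kstar_path k l) e.
Proof.
move=> sym_e l_gt0 upc szp szc ep degc.
have [p0 p0p] : exists x, x \in p.
  by case: p szp {upc ep} l_gt0 => [<- //|x p _ _]; exists x; rewrite mem_head.
pose A := [set x in p ++ c].
have cardA : #|A| = l + k by rewrite cardsE (card_uniqP upc) size_cat szp szc.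
have [i lt_ik|S [propS disS]] := @exists_leaf_sets T e A (nth p0 c) l.-1 k.
  rewrite (leq_trans _ (degc _ _)) ?mem_nth ?szc // cardA.
  by case: (l) l_gt0 => // l' _ /=; rewrite !mulSn; lia.
have not_pc x i : i < k -> x \in S i -> x \notin p ++ c.
  move=> ik xS; case: (propS i ik) => _ /pred0P/(_ x)/=.
  by rewrite xS inE /= => ->.
move: upc; rewrite cat_uniq => /and3P[up /hasPn dispc uc].
(* Star vertex [0] is the centre; a vertex [x > 0] takes leaf number [x.-1], since [S i] has [l.-1]
   elements. *)
pose f (u : kstar_path_type k l) := match u with
  | inl (i, x) => if x == 0 :> nat then nth p0 c i else nth p0 (enum (S i)) x.-1
  | inr x => nth p0 p x end.
have f_leaf (i : 'I_k) (x : 'I_l) : x != 0 :> nat -> nth p0 (enum (S i)) x.-1 \in S i.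
  move=> x0; rewrite -mem_enum mem_nth // -cardE.
  by case: (propS i (ltn_ord i)) => _ _ ->; have := ltn_ord x; lia.
have pP (x : 'I_l) : nth p0 p x \in p by rewrite mem_nth ?szp.
have cP (i : 'I_k) : nth p0 c i \in c by rewrite mem_nth ?szc.
exists f; split=> [u v|u v].
  have sep i x y : f (inl (i, x)) != f (inr y).
    apply/eqP => /= E; have := pP y; rewrite -E; case: eqP => [x0|/eqP x0].
      by apply/negP/dispc.
    by apply/negP; have := not_pc _ _ (ltn_ord i) (f_leaf i x x0); rewrite mem_cat negb_or => /andP[].
  case: u v => [[i x]|x] [[j y]|y].
  - rewrite /f; case: ifP => x0; case: ifP => y0.
    + move/eqP; rewrite nth_uniq ?szc // => /eqP/val_inj ->.
      by congr (inl (_, _)); apply/val_inj; rewrite /= (eqP x0) (eqP y0).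
    + move=> E; have := not_pc _ _ (ltn_ord j) (f_leaf j y (negbT y0)).
      by rewrite -E mem_cat cP orbT.
    + move=> E; have := not_pc _ _ (ltn_ord i) (f_leaf i x (negbT x0)).
      by rewrite E mem_cat cP orbT.
    + move=> E; have Sx := f_leaf i x (negbT x0); have Sy := f_leaf j y (negbT y0).
      case: (eqVneq i j) => [ij|nij].
        move: E; rewrite -ij => /eqP; rewrite nth_uniq ?enum_uniq //.
        * move=> /eqP xy; congr (inl (_, _)); apply/val_inj => /=.
          by move/negbT: x0; move/negbT: y0; lia.
        * rewrite -cardE; case: (propS i (ltn_ord i)) => _ _ ->.
          by have := ltn_ord x; move/negbT: x0; lia.
        * rewrite -cardE; case: (propS i (ltn_ord i)) => _ _ ->.
          by have := ltn_ord y; move/negbT: y0; lia.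
      have := disS _ _ (ltn_ord i) (ltn_ord j) nij => /pred0P/(_ (nth p0 (enum (S i)) x.-1)).
      by rewrite /= Sx E Sy.
  - by move=> E; have := sep i x y; rewrite E eqxx.
  - by move=> E; have := sep j y x; rewrite E eqxx.
  - by move=> /eqP; rewrite nth_uniq ?szp // => /eqP/val_inj ->.
have leafE (i : 'I_k) (y : 'I_l) : y != 0 :> nat -> e (nth p0 c i) (nth p0 (enum (S i)) y.-1).
  move=> y0; have := f_leaf i y y0; case: (propS i (ltn_ord i)) => /subsetP sS _ _ /sS.
  by rewrite inE.
have pathE (x y : 'I_l) : x.+1 = y :> nat -> e (nth p0 p x) (nth p0 p y).
  by move=> xy; rewrite -xy; apply: (sortedP p0 ep); rewrite xy szp.
case: u v => [[i x]|x] [[j y]|y]; rewrite /kstar_path //.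
  rewrite /star_rel => /andP[/eqP <- /andP[xy]]; case: (eqVneq (x : nat) 0) => [x0 _|x0 /= /eqP y0].
    rewrite /f x0 eqxx ifN; first apply: leafE.
      by apply: contraNneq xy => y0; apply/eqP/val_inj; rewrite /= x0 y0.
    by apply: contraNneq xy => y0; apply/eqP/val_inj; rewrite /= x0 y0.
  by rewrite /f y0 eqxx ifN // sym_e leafE.
by rewrite /path_rel => /orP[] /eqP/pathE //; rewrite sym_e.
Qed.

Lemma exists_notin_seq (T : finType) (A : {set T}) (s : seq T) :
  size s < #|A| -> exists2 x, x \in A & x \notin s.
Proof.
move=> lt_sA; have /card_gt0P [x] : 0 < #|A :\: [set y in s]|.
  have := cardsID [set y in s] A; have := subset_leq_card (subsetIr A [set y in s]).
  have : #|[set y in s]| <= size s by rewrite cardsE card_size.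
  lia.
by rewrite !inE => /andP[xs xA]; exists x.
Qed.

(** The path grows at its head, which has a fresh neighbour in [U] as long as fewer than [d]
    vertices are used. *)
Lemma exists_long_path (T : finType) (e : rel T) (U : {set T}) (x : T) (d m : nat) :
  symmetric e -> x \in U -> {in U, forall u, d <= #|nbr e u :&: U|} -> m < d ->
  exists p, [/\ uniq p, size p = m.+1, sorted e p & {subset p <= U}].
Proof.
move=> sym_e xU degU; elim: m => [|m IHm] lt_md.
  by exists [:: x]; split=> // y; rewrite inE => /eqP ->.
have [[|y p] [//= up [szp] ep sp]] := IHm (ltnW lt_md).
have [|z] := @exists_notin_seq T (nbr e y :&: U) (y :: p).
  by rewrite /= szp (leq_trans lt_md) // degU // sp ?mem_head.
rewrite !inE => /andP[eyz zU] zyp; exists [:: z, y & p]; split=> //=.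
- by rewrite inE zyp.
- by rewrite szp.
- by rewrite sym_e eyz.
- by move=> w; rewrite inE => /predU1P[-> //|/sp].
Qed.

(** Otherwise [U] contains a greedy path on [l + k] vertices: its first [l] vertices serve as the
    path and its last [k], all of large degree, as star centres. *)
Lemma Ffree_low_degree (T : finType) (e : rel T) (k l : nat) (U : {set T}) :
  symmetric e -> 1 < l -> Ffree (kstar_path k l) e -> U != set0 ->
  exists2 u, u \in U & #|nbr e u :&: U| < k.+1 * l.
Proof.
move=> sym_e l_gt1 freeG /set0Pn [x xU].
case: (boolP [exists u in U, #|nbr e u :&: U| < k.+1 * l]) => [/exists_inP //|].
rewrite negb_exists_in => /forall_inP degU; case: freeG.
have geU : {in U, forall u, k.+1 * l <= #|nbr e u :&: U|} by move=> u uU; rewrite leqNgt degU.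
have lt_lk : (l + k).-1 < k.+1 * l by rewrite mulSn; case: (l) l_gt1 => // l' _ /=; nia.
have [p [up szp ep sp]] := exists_long_path sym_e xU geU lt_lk.
have {}szp : size p = l + k by rewrite szp prednK // addn_gt0 ltnW.
apply: (@contains_kstar_path _ e k l (take l p) (drop l p)); rewrite ?cat_take_drop //.
- exact: ltnW.
- by rewrite size_takel // szp leq_addr.
- by rewrite size_drop szp addKn.
- exact: take_sorted.
- move=> u /mem_drop /sp /geU /leq_trans; apply.
  by rewrite subset_leq_card // subsetIl.
Qed.

Lemma sum_deg_setD1 (T : finType) (e : rel T) (A B : {set T}) (b : T) :
  symmetric e -> b \in B ->
  \sum_(a in A) #|nbr e a :&: B| = \sum_(a in A) #|nbr e a :&: (B :\ b)| + #|nbr e b :&: A|.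
Proof.
move=> sym_e bB; rewrite -sum1_card.
rewrite [X in _ = _ + X](eq_bigl (fun a => (a \in A) && e b a)); last first.
  by move=> a; rewrite !inE andbC.
rewrite big_mkcondr -big_split /=; apply: eq_bigr => a _.
rewrite (cardsD1 b) !inE bB andbT addnC sym_e setIDA; congr (_ + _).
Qed.

(** Degeneracy: vertices of low degree are deleted one by one, each deletion costing its degree
    twice. *)
Lemma Ffree_sum_deg (T : finType) (e : rel T) (k l : nat) (U : {set T}) :
  symmetric e -> 1 < l -> Ffree (kstar_path k l) e ->
  \sum_(u in U) #|nbr e u :&: U| <= 2 * (k.+1 * l) * #|U|.
Proof.
move=> sym_e l_gt1 freeG; have [m leUm] := ubnP #|U|.
elim: m U leUm => // m IHm U leUm.
have [->|U0] := eqVneq U set0; first by rewrite big_set0.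
have [u uU degu] := Ffree_low_degree sym_e l_gt1 freeG U0.
have cardU := cardsD1 u U; rewrite uU in cardU.
have /IHm : #|U :\ u| < m by lia.
rewrite (sum_deg_setD1 U sym_e uU) (big_setD1 u uU) /= cardU.
have : #|nbr e u :&: (U :\ u)| <= #|nbr e u :&: U|.
  by rewrite subset_leq_card // setIS // subsetDl.
lia.
Qed.

(** * Alternating paths and the bipartite edge bound *)

Fixpoint interleave (T : Type) (s1 s2 : seq T) : seq T :=
  match s1, s2 with
  | x1 :: s1', x2 :: s2' => x1 :: x2 :: interleave s1' s2'
  | _, _ => [::]
  end.

Lemma interleave_cat (T : Type) (s1 s2 t1 t2 : seq T) : size s1 = size s2 ->
  interleave (s1 ++ t1) (s2 ++ t2) = interleave s1 s2 ++ interleave t1 t2.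
Proof. by elim: s1 s2 => [|x s1 IH] [|y s2] //= [/IH ->]. Qed.

Lemma size_interleave (T : Type) (s1 s2 : seq T) : size s1 = size s2 ->
  size (interleave s1 s2) = (size s1).*2.
Proof. by elim: s1 s2 => [|x s1 IH] [|y s2] //= [/IH ->]. Qed.

Lemma perm_interleave (T : eqType) (s1 s2 : seq T) : size s1 = size s2 ->
  perm_eq (interleave s1 s2) (s1 ++ s2).
Proof.
elim: s1 s2 => [|x s1 IH] [|y s2] //= [/IH eqs].
by rewrite perm_cons -cat_rcons -cats1 -catA perm_sym perm_catCA /= perm_cons perm_sym.
Qed.

(** The path grows at its head by one vertex of [B] and then one of [A]. It always has one more
    vertex in [A] than in [B], hence the strict degree bound on [B]. The two sides are kept as
    separate lists so that the vertices of [B] can later be split. *)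
Lemma exists_interleaved_path (T : finType) (e : rel T) (A B : {set T}) (x : T) (d m : nat) :
  symmetric e -> [disjoint A & B] -> x \in A ->
  {in A, forall a, d <= #|nbr e a :&: B|} -> {in B, forall b, d < #|nbr e b :&: A|} ->
  m <= d ->
  exists a0 bs as_, [/\ size bs = m, size as_ = m, {subset bs <= B},
    {subset a0 :: as_ <= A} & uniq (a0 :: as_) /\ uniq bs /\ path e a0 (interleave bs as_)].
Proof.
move=> sym_e disAB xA degA degB; elim: m => [|m IHm] lt_md.
  exists x, [::], [::]; split=> // y; rewrite inE => /eqP -> //.
have [a [bs [as_ [szb sza sb sa [ua [ub pe]]]]]] := IHm (ltnW lt_md).
have [|b] := @exists_notin_seq T (nbr e a :&: B) bs.
  by rewrite szb (leq_trans lt_md) // degA // sa ?mem_head.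
rewrite !inE => /andP[eab bB] bbs.
have [|a'] := @exists_notin_seq T (nbr e b :&: A) (a :: as_).
  by rewrite /= sza (leq_ltn_trans lt_md) // degB.
rewrite !inE => /andP[eba' aA'] aas'.
exists a', (b :: bs), (a :: as_); split=> /=; rewrite ?szb ?sza //.
- by move=> y; rewrite inE => /predU1P[-> //|/sb].
- by move=> y; rewrite inE => /predU1P[-> //|/sa].
- by rewrite inE aas' bbs sym_e eba' sym_e eab; split.
Qed.

(** Vertices of small degree to the other side are deleted from [A] or [B]. If none is left, an
    alternating path with [k + l./2] vertices in [B] exists; [l./2] of these go to the path of the
    forbidden graph and the other [k] are star centres. *)
Lemma Ffree_bipartite (T : finType) (e : rel T) (k l : nat) (A B : {set T}) :
  symmetric e -> 1 < l -> Ffree (kstar_path k l) e -> [disjoint A & B] ->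
  \sum_(a in A) #|nbr e a :&: B| <= (k + l./2).-1 * #|A| + k.+1 * l * #|B|.
Proof.
move=> sym_e l_gt1 freeG; have [m] := ubnP (#|A| + #|B|).
have half_gt0 : 0 < l./2 by rewrite half_gt0.
elim: m A B => // m IHm A B leABm disAB.
have [->|/set0Pn [x xA]] := eqVneq A set0; first by rewrite big_set0.
case: (boolP [exists a in A, #|nbr e a :&: B| <= (k + l./2).-1]) => [/exists_inP [a aA dega]|].
  have cardA := cardsD1 a A; rewrite aA in cardA.
  have lt_m : #|A :\ a| + #|B| < m by lia.
  have := IHm _ _ lt_m (disjointWl (subsetDl A _) disAB).
  by rewrite (big_setD1 a aA) /= cardA; lia.
rewrite negb_exists_in => /forall_inP degA.
case: (boolP [exists b in B, #|nbr e b :&: A| <= k.+1 * l]) => [/exists_inP [b bB degb]|].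
  have cardB := cardsD1 b B; rewrite bB in cardB.
  have lt_m : #|A| + #|B :\ b| < m by lia.
  have := IHm _ _ lt_m (disjointWr (subsetDl B _) disAB).
  by rewrite (sum_deg_setD1 A sym_e bB) /= cardB; lia.
rewrite negb_exists_in => /forall_inP degB; case: freeG.
have geA : {in A, forall a, k + l./2 <= #|nbr e a :&: B|} by move=> a /degA; lia.
have gtB : {in B, forall b, k + l./2 < #|nbr e b :&: A|}.
  by move=> b /degB; rewrite -ltnNge; apply: leq_ltn_trans; nia.
have [a [bs [as_ [szb sza sb sa [ua [ub pe]]]]]] :=
  exists_interleaved_path sym_e disAB xA geA gtB (leqnn _).
(* Starting and ending in [A], this piece has [(l./2).*2.+1 >= l] vertices while using only [l./2]
   vertices of [B], for either parity of [l]. *)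
pose q := a :: interleave (take l./2 bs) (take l./2 as_).
have szt : size (take l./2 bs) = size (take l./2 as_) by rewrite !size_takel ?szb ?sza ?leq_addl.
have eq_int : a :: interleave bs as_ = q ++ interleave (drop l./2 bs) (drop l./2 as_).
  by rewrite /q /= -interleave_cat // !cat_take_drop.
have szq : l <= size q by rewrite /= size_interleave // size_takel ?szb ?leq_addl //; lia.
have q_sub y : y \in q -> (y \in A) || (y \in take l./2 bs).
  rewrite inE (perm_mem (perm_interleave szt)) mem_cat => /or3P[/eqP ->|->|/mem_take ya].
  - by rewrite sa ?mem_head.
  - by rewrite orbT.
  - by rewrite sa // inE ya orbT.
have notAB y : y \in A -> y \in bs -> False.
  by move=> yA /sb yB; have /pred0P/(_ y) := disAB; rewrite /= yA yB.
apply: (@contains_kstar_path _ e k l (take l q) (drop l./2 bs)) => //.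
- exact: ltnW.
- rewrite cat_uniq drop_uniq // andbT; apply/andP; split.
    rewrite take_uniq //= (perm_uniq (perm_interleave szt)) (perm_mem (perm_interleave szt)).
    rewrite mem_cat negb_or cat_uniq !take_uniq // ?andbT //=; last by case/andP: ua.
    have -> /= : a \notin take l./2 bs.
      by apply/negP => /mem_take; apply: notAB; rewrite sa ?mem_head.
    have -> /= : a \notin take l./2 as_.
      by apply/negP => /mem_take ya; move: ua; rewrite /= ya.
    apply/hasPn => y /mem_take ya; apply/negP => /mem_take; apply: notAB.
    by rewrite sa // inE ya orbT.
  apply/hasPn => y yd; apply/negP => /mem_take/q_sub/orP[yA|yt].
    exact: notAB yA (mem_drop yd).
  by move: ub; rewrite -[bs](cat_take_drop l./2) cat_uniq => /and3P[_ /hasPn/(_ y yd)]; rewrite yt.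
- by rewrite size_takel.
- by rewrite size_drop szb; lia.
- apply: take_sorted; have : sorted e (a :: interleave bs as_) by [].
  by rewrite eq_int => /cat_sorted2[].
- move=> y /mem_drop/sb/degB; rewrite -ltnNge => /ltnW/leq_trans; apply.
  by rewrite subset_leq_card // subsetIl.
Qed.

(** * Edges avoiding a dominating set *)

Lemma exists_uniq_fresh (T : finType) (A : {set T}) (s : seq T) (m : nat) :
  size s + m <= #|A| ->
  exists r, [/\ uniq r, size r = m & forall x, x \in r -> x \in A /\ x \notin s].
Proof.
move=> le_mA; have /card_geqP [r [ur szr rP]] : m <= #|A :\: [set y in s]|.
  have := cardsID [set y in s] A; have := subset_leq_card (subsetIr A [set y in s]).
  have : #|[set y in s]| <= size s by rewrite cardsE card_size.
  lia.
by exists r; split=> // x /rP; rewrite !inE => /andP[].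
Qed.

Lemma path_interleave (T : finType) (e : rel T) (L R : {set T}) (b : T) (s1 s2 : seq T) :
  symmetric e -> {in R & L, forall a w, e a w} -> b \in L ->
  {subset s1 <= R} -> {subset s2 <= L} ->
  path e b (interleave s1 s2) /\ last b (interleave s1 s2) \in L.
Proof.
move=> sym_e RL; elim: s1 s2 b => [|x s1 IH] [|y s2] b //= bL sR sL.
have xR : x \in R by rewrite sR ?mem_head.
have yL : y \in L by rewrite sL ?mem_head.
have [||-> ->] := IH s2 y yL.
- by move=> z zs; rewrite sR // inE zs orbT.
- by move=> z zs; rewrite sL // inE zs orbT.
by rewrite sym_e !RL.
Qed.

(** The two outer pieces are joined by a zigzag through [l./2 - 1] vertices of [L] and [l./2 - 2]
    fresh vertices of [R], which gives [size s + size t + (l./2).*2 - 1 = l] vertices. The other [k]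
    vertices of [L] are star centres, with leaves available in [R]. *)
Lemma Ffree_no_linking (T : finType) (e : rel T) (k l : nat) (L R : {set T})
    (s t : seq T) (a a' : T) :
  symmetric e -> 3 < l -> Ffree (kstar_path k l) e ->
  #|L| = (k + l./2).-1 -> k.+1 * l <= #|R| -> [disjoint R & L] ->
  {in R & L, forall a w, e a w} ->
  sorted e (rcons s a) -> path e a' t -> a \in R -> a' \in R ->
  uniq (rcons s a ++ a' :: t) -> {in rcons s a ++ a' :: t, forall x, x \notin L} ->
  size s + size t + (l./2).*2 = l.+1 -> False.
Proof.
move=> sym_e l_gt3 freeG cardL cardR disRL RL es et aR a'R ust stL szst; apply: freeG.
have half_gt1 : 1 < l./2 by lia.
pose bs := drop k (enum L).
have szb : size bs = l./2.-1 by rewrite size_drop -cardE cardL; lia.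
case def_bs : bs szb => [|b bs' /=]; first by move=> /= E; lia.
move=> szb; have [|as_ [ua sza asP]] := @exists_uniq_fresh T R (rcons s a ++ a' :: t) (size bs').
  by rewrite size_cat size_rcons /= (leq_trans _ cardR) //; nia.
have bsL : {subset b :: bs' <= L} by rewrite -def_bs => x /mem_drop; rewrite mem_enum.
have [||pX lX] := @path_interleave T e L R b as_ bs' sym_e RL (bsL b (mem_head _ _)).
- by move=> x /asP[].
- by move=> x xb; rewrite bsL // inE xb orbT.
pose p := rcons s a ++ (b :: interleave as_ bs') ++ a' :: t.
apply: (@contains_kstar_path _ e k l p (take k (enum L))) => //.
- exact: ltn_trans l_gt3.
- have eqp : perm_eq (p ++ take k (enum L)) ((rcons s a ++ a' :: t) ++ as_ ++ enum L).
    apply/permP => x; rewrite /p -[in RHS](cat_take_drop k (enum L)) -/bs def_bs.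
    rewrite !count_cat /= (permP (perm_interleave sza)) count_cat; ring.
  rewrite (perm_uniq eqp) cat_uniq ust /= cat_uniq ua enum_uniq /= andbT.
  apply/andP; split; apply/hasPn => x.
    rewrite mem_cat => /orP[/asP[] //|]; rewrite mem_enum => xL.
    by apply/negP => /stL; rewrite xL.
  rewrite mem_enum => xL; apply/negP => /asP[xR _].
  by have /pred0P/(_ x) := disRL; rewrite /= xR xL.
- rewrite /p !size_cat size_rcons /= size_interleave // sza; lia.
- by rewrite size_takel // -cardE cardL; lia.
- have eab : e a b by rewrite RL // bsL // mem_head.
  have ela' : e (last b (interleave as_ bs')) a' by rewrite sym_e RL.
  rewrite /p; case: s es {ust stL szst asP p} => [_|x s] /=.
    by rewrite eab cat_path pX /= ela' et.
  by rewrite cat_path last_rcons => -> /=; rewrite eab cat_path pX /= ela' et.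
- move=> x /mem_take; rewrite mem_enum => xL; apply: leq_trans cardR _.
  by apply/subset_leq_card/subsetP => y yR; rewrite inE sym_e RL.
Qed.

(** With [s] and [t] empty the linked path has [(l./2).*2 - 1] vertices. For even [l] one more
    vertex is enough, so a single edge at one end is fatal. For odd [l] two more are required,
    either both at one end or one at each end; these are the two lemmas that follow. *)
Lemma Ffree_even_no_edge (T : finType) (e : rel T) (k l : nat) (L R : {set T}) (a v : T) :
  symmetric e -> irreflexive e -> 3 < l -> Ffree (kstar_path k l) e ->
  #|L| = (k + l./2).-1 -> k.+1 * l <= #|R| -> [disjoint R & L] ->
  {in R & L, forall a w, e a w} ->
  ~~ odd l -> a \in R -> v \notin L -> e v a = false.
Proof.
move=> sym_e irr_e l_gt3 freeG cardL cardR disRL RL evl aR vL; apply/negP => eva.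
have [|a' a'R] := @exists_notin_seq T R [:: v; a].
  by rewrite (leq_trans _ cardR) //=; nia.
rewrite !inE negb_or => /andP[a'v a'a].
have notL y : y \in R -> y \notin L by move/(disjointFr disRL) ->.
apply: (@Ffree_no_linking T e k l L R [:: v] [::] a a') => //=.
- by rewrite eva.
- rewrite !inE !negb_or eq_sym [v == a']eq_sym [a == a']eq_sym a'v a'a !andbT.
  by apply/eqP => E; rewrite E irr_e in eva.
- by move=> y; rewrite !inE => /or3P[] /eqP -> //; apply: notL.
- by have := odd_double_half l; rewrite (negbTE evl); lia.
Qed.

Lemma Ffree_odd_no_path3 (T : finType) (e : rel T) (k l : nat) (L R : {set T}) (a v w : T) :
  symmetric e -> irreflexive e -> 3 < l -> Ffree (kstar_path k l) e ->
  #|L| = (k + l./2).-1 -> k.+1 * l <= #|R| -> [disjoint R & L] ->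
  {in R & L, forall a w, e a w} ->
  odd l -> a \in R -> v \notin L -> w \notin L -> w != a -> e w v -> e v a -> False.
Proof.
move=> sym_e irr_e l_gt3 freeG cardL cardR disRL RL oddl aR vL wL wa ewv eva.
have [|a' a'R] := @exists_notin_seq T R [:: w; v; a].
  by rewrite (leq_trans _ cardR) //=; nia.
rewrite !inE !negb_or => /and3P[a'w a'v a'a].
have notL y : y \in R -> y \notin L by move/(disjointFr disRL) ->.
have neq x y : e x y -> x != y by move=> exy; apply/eqP => E; rewrite E irr_e in exy.
apply: (@Ffree_no_linking T e k l L R [:: w; v] [::] a a') => //=.
- by rewrite ewv eva.
- rewrite !inE !negb_or [w == a']eq_sym [v == a']eq_sym [a == a']eq_sym.
  by rewrite a'w a'v a'a wa !neq.
- by move=> y; rewrite !inE => /or4P[] /eqP -> //; apply: notL.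
- by have := odd_double_half l; rewrite oddl; lia.
Qed.

Lemma Ffree_odd_no_matching (T : finType) (e : rel T) (k l : nat) (L R : {set T})
    (a v a' v' : T) :
  symmetric e -> 3 < l -> Ffree (kstar_path k l) e ->
  #|L| = (k + l./2).-1 -> k.+1 * l <= #|R| -> [disjoint R & L] ->
  {in R & L, forall a w, e a w} ->
  odd l -> a \in R -> a' \in R -> v \notin L -> v' \notin L -> uniq [:: v; a; a'; v'] ->
  e v a -> e a' v' -> False.
Proof.
move=> sym_e l_gt3 freeG cardL cardR disRL RL oddl aR a'R vL v'L uniq4 eva ea'v'.
have notL y : y \in R -> y \notin L by move/(disjointFr disRL) ->.
apply: (@Ffree_no_linking T e k l L R [:: v] [:: v'] a a') => //=.
- by rewrite eva.
- by rewrite ea'v'.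
- by move=> y; rewrite !inE => /or4P[] /eqP -> //; apply: notL.
- by have := odd_double_half l; rewrite oddl; lia.
Qed.

Lemma card_edges_within (T : finType) (e : rel T) (E : {set T}) :
  #|[set u : T * T | [&& u.1 \in E, u.2 \in E & e u.1 u.2]]| =
  \sum_(u in E) #|nbr e u :&: E|.
Proof.
rewrite -sum1_card (eq_bigl (fun u : T * T => (u.1 \in E) && ((u.2 \in E) && e u.1 u.2))).
  rewrite -(pair_big_dep (mem E) (fun u v => (v \in E) && e u v) (fun _ _ => 1)) /=.
  by apply: eq_bigr => u _; rewrite sum1dep_card; apply: eq_card => v; rewrite !inE andbC.
by move=> u; rewrite inE.
Qed.

(* With [L] the dominating vertices and [R] their common neighbours, almost all
   edges avoiding [L] lie in the exceptional set [E]; for odd [l] the pair [P] is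
   where the extra edge of the extremal graph has to be placed. *)
Lemma Ffree_few_extra_edges (T : finType) (e : rel T) (k l : nat) (L R : {set T}) :
  symmetric e -> irreflexive e -> 3 < l -> Ffree (kstar_path k l) e ->
  #|L| = (k + l./2).-1 -> k.+1 * l <= #|R| -> [disjoint R & L] ->
  {in R & L, forall a w, e a w} ->
  exists P : {set T}, [/\ #|P| = (odd l).*2, [disjoint P & L] &
    #|[set u : T * T | [&& e u.1 u.2, u.1 \notin L, u.2 \notin L &
        ~~ ((u.1 \in P) && (u.2 \in P))]]| <= (2 * (k.+1 * l) + 2) * #|~: (L :|: R)|].
Proof.
move=> sym_e irr_e l_gt3 freeG cardL cardR disRL RL; set E := ~: _.
have notL y : y \in R -> y \notin L by move/(disjointFr disRL) ->.
have l_gt1 : 1 < l by lia.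
have edgesE := Ffree_sum_deg E sym_e l_gt1 freeG.
rewrite -card_edges_within in edgesE.
set EE := [set u | _] in edgesE.
have inE' u : u \notin L -> u \notin R -> u \in E by rewrite !inE => /negbTE -> /negbTE ->.
have no_edge_case (P : {set T}) :
    (forall a v, a \in R -> v \notin L -> e v a = false) ->
    #|[set u : T * T | [&& e u.1 u.2, u.1 \notin L, u.2 \notin L &
        ~~ ((u.1 \in P) && (u.2 \in P))]]| <= (2 * (k.+1 * l) + 2) * #|E|.
  move=> noR; apply: leq_trans (leq_trans edgesE _); last by rewrite mulnDl leq_addr.
  apply/subset_leq_card/subsetP => -[u v]; rewrite !inE /= => /and4P[euv uL vL _].
  rewrite euv (negbTE uL) (negbTE vL) /= andbT; apply/andP; split; apply/negP => hR.
    by rewrite sym_e noR in euv.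
  by rewrite noR in euv.
case: (boolP (odd l)) => oddl; last first.
  exists set0; split; rewrite ?cards0 //; first by rewrite disjoints_subset sub0set.
  apply: no_edge_case => a v aR vL.
  exact: (Ffree_even_no_edge sym_e irr_e l_gt3 freeG cardL cardR disRL RL oddl aR vL).
case: (boolP [exists p in R, [exists q, (q \notin L) && e p q]]); last first.
  rewrite negb_exists_in => /forall_inP noR.
  (* No edge avoiding [L] meets [R], so any two vertices of [R] can play the role of [P]. *)
  have [|r [ur szr rP]] := @exists_uniq_fresh T R [::] 2.
    by rewrite (leq_trans _ cardR) //=; nia.
  exists [set y in r]; split; first by rewrite cardsE (card_uniqP ur) szr.
    by apply/pred0P => y /=; rewrite inE; case: (boolP (y \in r)) => //= /rP[/notL/negbTE].
  apply: no_edge_case => a v aR vL; have := noR a aR; rewrite negb_exists => /forallP/(_ v).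
  by rewrite vL /= sym_e => /negbTE.
case/exists_inP => p pR /existsP[q /andP[qL epq]].
have neq x y : e x y -> x != y by move=> exy; apply/eqP => E'; rewrite E' irr_e in exy.
have pL := notL p pR.
exists [set p; q]; split; first by rewrite cards2 neq.
  apply/pred0P => y /=; apply/negP => /andP[]; rewrite in_set2 => /orP[] /eqP ->.
    exact: (negP pL).
  exact: (negP qL).
(* Any other edge at [R] forms, together with [p q], a path on three vertices or a matching, both
   excluded; only edges from [p] into [E] survive. *)
have key u v : u \in R -> v \notin L -> e u v ->
    ~~ ((u \in [set p; q]) && (v \in [set p; q])) -> u = p /\ v \in E.
  move=> uR vL euv notP; have uL := notL u uR.
  have path3 := @Ffree_odd_no_path3 T e k l L R _ _ _ sym_e irr_e l_gt3 freeG cardL cardR disRL RL oddl.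
  case: (eqVneq u p) => [up|up].
    split=> //; apply: inE' => //; apply/negP => vR; rewrite {}up in euv notP.
    apply: (path3 v p q) => //; last by rewrite sym_e.
    by apply: contraNneq notP => <-; rewrite !inE !eqxx orbT.
  exfalso; case: (eqVneq u q) => [uq|uq].
    rewrite {}uq in euv notP; apply: (path3 p q v) => //; try by rewrite sym_e.
    by apply: contraNneq notP => ->; rewrite !inE !eqxx orbT.
  case: (eqVneq v p) => [vp|vp].
    rewrite {}vp in euv notP; apply: (path3 u p q) => //; try by rewrite sym_e.
    by rewrite eq_sym.
  case: (eqVneq v q) => [vq|vq].
    by rewrite {}vq in euv notP; apply: (path3 p q u) => //; rewrite sym_e.
  apply: (@Ffree_odd_no_matching T e k l L R p q u v) => //; last by rewrite sym_e.
  by rewrite /= !inE !negb_or [q == p]eq_sym neq // ![q == _]eq_sym uq vq ![p == _]eq_sym up vp neq.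
(* Edges are counted as ordered pairs: those between [p] and [E] account for the extra
   [2 * #|E|]. *)
rewrite (_ : _ * #|E| = 2 * (k.+1 * l) * #|E| + (#|E| + #|E|)); last by rewrite mulnDl; lia.
apply: (@leq_trans #|EE :|: (setX [set p] E :|: setX E [set p])|).
  apply/subset_leq_card/subsetP => -[u v]; rewrite [_ \in EE :|: _]inE !in_setU !in_setX inE /=.
  case/and4P=> euv uL vL notP; rewrite !in_set1.
  case: (boolP (u \in R)) => uR.
    by have [-> vE] := key u v uR vL euv notP; rewrite eqxx vE !orbT.
  case: (boolP (v \in R)) => vR.
    have evu : e v u by rewrite sym_e.
    have [|-> uE] := key v u vR uL evu; first by rewrite andbC.
    by rewrite eqxx uE !orbT.
  by rewrite [_ \in EE]inE /= !inE' // euv.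
apply: leq_trans (leq_card_setU _ _) _; rewrite leq_add //.
by apply: leq_trans (leq_card_setU _ _) _; rewrite !cardsX cards1 mul1n muln1.
Qed.

(** * The extremal graphs *)

(* [L] is a dominating clique and [P] a clique: [S_{n,h}] is the case [#|L| = h],
   [P] empty, and [S^+_{n,h}] the case [#|L| = h], [#|P| = 2]. *)
Definition join_graph (T : finType) (L P : {set T}) : rel T :=
  fun x y => (x != y) && [|| x \in L, y \in L | (x \in P) && (y \in P)].

Lemma join_graph_simple (T : finType) (L P : {set T}) : simple_graph (join_graph L P).
Proof.
split=> [x y|x]; rewrite /join_graph ?eqxx // eq_sym; congr (_ && _).
by rewrite orbCA [(x \in P) && _]andbC.
Qed.

Lemma join_graph_touch (T : finType) (L P : {set T}) (x y : T) :
  join_graph L P x y -> ~~ ((x \in P) && (y \in P)) -> (x \in L) || (y \in L).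
Proof. by rewrite /join_graph => /andP[_]; rewrite orbA => /orP[|->]. Qed.

Lemma uniq3_card (T : finType) (P : {set T}) (x y z : T) :
  uniq [:: x; y; z] -> x \in P -> y \in P -> z \in P -> 2 < #|P|.
Proof.
move=> u xP yP zP; apply/card_geqP; exists [:: x; y; z]; split=> // w.
by rewrite !inE => /or3P[] /eqP ->.
Qed.

(** A counting argument. Outside [L] only the at most two vertices of [P] span an edge, so each star
    meets [L], and the path has [l./2] disjoint edges each meeting [L]. The copy thus needs
    [k + l./2] vertices of [L]. *)
Lemma join_graph_Ffree (T : finType) (L P : {set T}) (k l : nat) :
  3 < l -> #|L| < k + l./2 -> #|P| = (odd l).*2 ->
  Ffree (kstar_path k l) (join_graph L P).
Proof.
move=> l_gt3 cardL cardP [f [inj_f ef]].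
have P_le2 : #|P| <= 2 by rewrite cardP; case: (odd l).
have star_hit (i : 'I_k) : exists x : 'I_l, f (inl (i, x)) \in L.
  apply/existsP; apply: contraT; rewrite negb_exists => /forallP notL.
  have [l0 l1 l2] : [/\ 0 < l, 1 < l & 2 < l] by split; lia.
  have edge (x : 'I_l) : x != 0 :> nat ->
      (f (inl (i, Ordinal l0)) \in P) && (f (inl (i, x)) \in P).
    move=> x0; have /ef : kstar_path k l (inl (i, Ordinal l0)) (inl (i, x)).
      by rewrite /= eqxx /star_rel /= andbT eq_sym.
    by rewrite /join_graph (negbTE (notL _)) (negbTE (notL _)) => /andP[].
  have /andP[P0 P1] := edge (Ordinal l1) isT; have /andP[_ P2] := edge (Ordinal l2) isT.
  suff U : uniq [:: f (inl (i, Ordinal l0)); f (inl (i, Ordinal l1)); f (inl (i, Ordinal l2))].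
    by have := uniq3_card U P0 P1 P2; rewrite ltnNge P_le2.
  have ne (x y : 'I_l) : x != y -> f (inl (i, x)) != f (inl (i, y)).
    by apply: contraNneq => /inj_f [->].
  by rewrite /= !inE negb_or !ne.
have l0 : 0 < l by lia.
(* Path positions become naturals so that successors can be written; beyond [l] the value is that of
   position [0]. *)
pose g y := f (inr (insubd (Ordinal l0) y)).
have g_inj y z : y < l -> z < l -> (g y == g z) = (y == z).
  move=> yl zl; rewrite /g (inj_eq inj_f); apply/eqP/eqP => [[E]|-> //].
  by have := congr1 val E; rewrite !val_insubd yl zl.
have g_edge y : y.+1 < l -> join_graph L P (g y) (g y.+1).
  move=> yl; apply: ef; rewrite /= /path_rel !insubdK ?eqxx // -topredE /=; lia.
have path_hit : exists off : nat -> nat, (forall i j, i < j -> (off i).+1 < off j) /\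
    forall i, i < l./2 -> (off i).+1 < l /\ (g (off i) \in L) || (g (off i).+1 \in L).
  have l_half := odd_double_half l.
  (* The edges at positions [2i], [2i+1] serve unless one of them, number [i0], lies in [P]. Then
     [l] is odd and there is room to shift the edges from [i0] on by one place; [P] being used up by
     positions [2i0] and [2i0+1], no chosen edge has both ends in [P]. *)
  case: (boolP [exists i : 'I_(l./2), (g i.*2 \in P) && (g i.*2.+1 \in P)]).
    case/existsP => i0 /andP[Pi0 Pi1].
    have odd_l : odd l.
      by move: cardP; case: (odd l) => //= /eqP; rewrite cards_eq0 => /eqP P0; rewrite P0 inE in Pi0.
    have i0l := ltn_ord i0; rewrite odd_l in l_half.
    have notP y : y < l -> y != i0.*2 -> y != i0.*2.+1 -> g y \notin P.
      move=> yl y0 y1; apply/negP => Py.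
      suff U : uniq [:: g i0.*2; g i0.*2.+1; g y].
        by have := uniq3_card U Pi0 Pi1 Py; rewrite ltnNge P_le2.
      rewrite /= !inE negb_or !g_inj //; [|lia..].
      by rewrite [_ == y]eq_sym y0 [_ == y]eq_sym y1 andbT; lia.
    exists (fun i => if i < i0 then i.*2 else i.*2.+1); split=> [i j ij|i il].
      by case: ifP; case: ifP; lia.
    case: ifP => ii0; (split; first lia).
      apply: join_graph_touch (g_edge _ _) _; first lia.
      by rewrite negb_and notP //; lia.
    apply: join_graph_touch (g_edge _ _) _; first lia.
    by rewrite negb_and (notP i.*2.+2) ?orbT //; lia.
  rewrite negb_exists => /forallP notP; exists double; split=> [i j|i il]; first lia.
  split; first lia.
  by apply: join_graph_touch (g_edge _ _) (notP (Ordinal il)); rewrite /=; lia.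
have [off [off_mono off_hit]] := path_hit.
have [xs xsP] := fin_all_exists star_hit.
pose pos i := if g (off i) \in L then off i else (off i).+1.
have pos_hit i : i < l./2 -> pos i < l /\ g (pos i) \in L.
  by rewrite /pos => /off_hit[offl]; case: ifP => //= Lo; split=> //; apply: ltnW.
have pos_inj i j : pos i = pos j -> i = j.
  rewrite /pos => E; case: (ltngtP i j) => [/off_mono|/off_mono|//]; move: E; do 2 case: ifP; lia.
pose phi (u : 'I_k + 'I_(l./2)) := match u with
  | inl i => f (inl (i, xs i)) | inr i => g (pos i) end.
have phi_inj : injective phi.
  move=> [i|i] [j|j] /=.
  - by move/inj_f => [->].
  - by move/inj_f.
  - by move/inj_f.
  - move/eqP; have [li _] := pos_hit i (ltn_ord i); have [lj _] := pos_hit j (ltn_ord j).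
    by rewrite g_inj // => /eqP/pos_inj/val_inj ->.
move: cardL; rewrite ltnNge => /negP; apply.
rewrite -[k in k + _]card_ord -[l./2]card_ord -card_sum -cardsT -(card_imset _ phi_inj).
apply/subset_leq_card/subsetP => y /imsetP[[i|i] _ ->]; first exact: xsP.
by case: (pos_hit i (ltn_ord i)).
Qed.

(** Both vertex sets are listed with [L] first, then [P], then the rest. The bijection matches
    positions, and the class of a vertex can be read off its position. *)
Lemma exists_bij_class (T : finType) (L P L' P' : {set T}) :
  #|L| = #|L'| -> #|P| = #|P'| -> [disjoint P & L] -> [disjoint P' & L'] ->
  exists f : T -> T, [/\ bijective f, forall x, (f x \in L') = (x \in L) &
    forall x, (f x \in P') = (x \in P)].
Proof.
move=> eqL eqP dis dis'.
pose s (A B : {set T}) := enum A ++ enum B ++ enum (~: (A :|: B)).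
have uniq_s (A B : {set T}) : [disjoint B & A] -> uniq (s A B).
  move=> disAB; rewrite /s !cat_uniq !enum_uniq /= andbT; apply/andP; split; apply/hasPn => x.
    rewrite mem_cat !mem_enum !inE negb_or => /orP[/(disjointFr disAB) -> //|/andP[]//].
  by rewrite !mem_enum !inE negb_or => /andP[].
have mem_s (A B : {set T}) x : x \in s A B.
  by rewrite !mem_cat !mem_enum !inE negb_or; case: (x \in A); case: (x \in B).
have size_s (A B : {set T}) : [disjoint B & A] -> size (s A B) = #|T|.
  move=> disAB; rewrite -(card_uniqP (uniq_s _ _ disAB)) -cardsT -cardsE.
  by apply: eq_card => x; rewrite !inE mem_s.
have inL (A B : {set T}) x : (x \in A) = (index x (s A B) < #|A|).
  rewrite index_cat mem_enum cardE; case: ifP => [xA|_]; last by rewrite ltnNge leq_addr.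
  by rewrite index_mem mem_enum.
have inP (A B : {set T}) x : [disjoint B & A] -> (x \in B) = (#|A| <= index x (s A B) < #|A| + #|B|).
  move=> disAB; rewrite leqNgt -inL; case: (boolP (x \in A)) => [xA|xA] /=.
    by rewrite (disjointFl disAB).
  rewrite index_cat mem_enum (negbTE xA) -cardE ltn_add2l index_cat mem_enum cardE.
  by case: ifP => [xB|_]; rewrite ?index_mem ?mem_enum // ltnNge leq_addr.
pose f x := nth x (s L' P') (index x (s L P)).
have idx x : index x (s L P) < size (s L' P').
  by rewrite size_s // -(size_s L P) // index_mem.
have idxf x : index (f x) (s L' P') = index x (s L P) by rewrite index_uniq ?uniq_s.
exists f; split=> [|x|x].
- apply: injF_bij => x y Exy; have := idxf y; rewrite -Exy idxf => E.
  by rewrite -(nth_index x (mem_s L P x)) E nth_index.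
- by rewrite (inL L' P') idxf -eqL -inL.
- by rewrite (inP L' P') // idxf -eqL -eqP -inP.
Qed.

Lemma join_graph_iso (T : finType) (L P L' P' : {set T}) :
  #|L| = #|L'| -> #|P| = #|P'| -> [disjoint P & L] -> [disjoint P' & L'] ->
  graph_iso (join_graph L P) (join_graph L' P').
Proof.
move=> eqL eqP dis dis'; have [f [bij_f fL fP]] := exists_bij_class eqL eqP dis dis'.
by exists f; split=> // x y; rewrite /join_graph !fL !fP (inj_eq (bij_inj bij_f)).
Qed.

Lemma graph_iso_join (T : finType) (e : rel T) (L P : {set T}) :
  graph_iso e (join_graph L P) -> [disjoint P & L] ->
  exists L' P' : {set T}, [/\ #|L'| = #|L|, #|P'| = #|P|, [disjoint P' & L'] & e =2 join_graph L' P'].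
Proof.
move=> [f [[g fK gK] ef]] dis; have inj_f := can_inj fK.
have on_f (A : {set T}) : #|f @^-1: A| = #|A|.
  by apply: on_card_preimset; exists g => x _; [apply: fK|apply: gK].
exists (f @^-1: L), (f @^-1: P); split=> // [|x y].
  by apply/pred0P => x /=; rewrite !inE; apply: (pred0P dis (f x)).
by rewrite ef /join_graph !inE (inj_eq inj_f).
Qed.

Lemma card_ord_interval (n a b : nat) : a + b <= n -> #|[set x : 'I_n | a <= x < a + b]| = b.
Proof.
move=> abn; have lt_n (i : 'I_b) : a + i < n by have := ltn_ord i; lia.
have inj : injective (fun i => Ordinal (lt_n i)).
  by move=> i j /(congr1 val) /= /addnI /val_inj.
rewrite -[RHS]card_ord -cardsT -(card_imset _ inj); apply: eq_card => x.
rewrite inE; apply/idP/imsetP => [/andP[ax xb]|[i _ ->]].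
  have lt_b : x - a < b by lia.
  by exists (Ordinal lt_b); rewrite ?inE //; apply: val_inj; rewrite /=; lia.
by rewrite /= leq_addr ltn_add2l ltn_ord.
Qed.

Lemma S_nh_join_graph (n h : nat) :
  S_nh n h =2 join_graph [set x : 'I_n | 0 <= x < 0 + h] set0.
Proof. by move=> x y; rewrite /S_nh /join_graph !inE orbF. Qed.

Lemma S_nh_plus_join_graph (n h : nat) :
  S_nh_plus n h =2 join_graph [set x : 'I_n | 0 <= x < 0 + h] [set x : 'I_n | h <= x < h + 2].
Proof.
move=> x y; rewrite /S_nh_plus /S_nh /join_graph !inE -!val_eqE /=.
case: (ltngtP x y); lia.
Qed.

(** * Spectral radius *)

Local Open Scope ring_scope.

Lemma sum_nbr_exchange (R : pzSemiRingType) (T : finType) (e : rel T) (f g : T -> R) :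
  symmetric e ->
  \sum_v f v * (\sum_(w | e v w) g w) = \sum_w (\sum_(v | e w v) f v) * g w.
Proof.
move=> sym_e; under eq_bigr do rewrite big_distrr.
under [RHS]eq_bigr do rewrite big_distrl.
rewrite (exchange_big_dep xpredT) //=; apply: eq_bigr => w _.
by apply: eq_bigl => v; rewrite sym_e.
Qed.

(** Absolute values of an eigenvector, scaled to maximum 1. The triangle inequality yields only an
    inequality, but this makes do without Perron-Frobenius theory and holds for every eigenvalue. *)
Lemma eigenvalue_subvector (R : realType) (n : nat) (e : rel 'I_n) (r : R) :
  symmetric e -> eigenvalue (adj_mx R e) r ->
  exists x : 'I_n -> R, [/\ forall v, 0 <= x v, forall v, x v <= 1, exists u, x u = 1 &
    forall v, r * x v <= \sum_(w | e v w) x w].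
Proof.
move=> sym_e /eigenvalueP [v vA v0].
have [i0 vi0] : exists i, v 0 i != 0.
  apply/existsP; apply: contraNT v0; rewrite negb_exists => /forallP z.
  by apply/eqP/rowP => i; rewrite mxE; have := z i; rewrite negbK => /eqP.
pose m := [arg max_(i > i0) `|v 0 i|]%O.
have m_max i : `|v 0 i| <= `|v 0 m|.
  by rewrite /m; case: arg_maxP => //= j _ /(_ i isT).
have m_gt0 : 0 < `|v 0 m| by apply: lt_le_trans (m_max i0); rewrite normr_gt0.
exists (fun i => `|v 0 i| / `|v 0 m|); split=> [i|i||i].
- by rewrite divr_ge0.
- by rewrite ler_pdivrMr // mul1r.
- by exists m; rewrite divff // gt_eqF.
rewrite -mulr_suml mulrA ler_wpM2r ?invr_ge0 //.
apply: (@le_trans _ _ `|r * v 0 i|); first by rewrite normrM ler_wpM2r // ler_norm.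
have /rowP/(_ i) := vA; rewrite !mxE => <-.
apply: le_trans (ler_norm_sum _ _ _) _; rewrite [leRHS]big_mkcond; apply: ler_sum => j _.
rewrite mxE normrM sym_e; case: (e i j); first by rewrite normr1 mulr1.
by rewrite normr0 mulr0.
Qed.

(** Pairing [z] with a subvector [x] of another eigenvalue [a] gives
    [a <z,x> <= <z,Ax> = rho <z,x>], where [<z,x>] is positive. *)
Lemma perron_spec_radius (R : realType) (n : nat) (e : rel 'I_n) (z : 'I_n -> R) (rho : R) :
  (0 < n)%N -> symmetric e -> (forall v, 0 < z v) ->
  (forall v, \sum_(w | e v w) z w = rho * z v) -> is_spec_radius e rho.
Proof.
move=> n_gt0 sym_e z_gt0 ez; split.
  apply/eigenvalueP; exists (\row_i z i).
    apply/rowP => i; rewrite !mxE -ez [RHS]big_mkcond; apply: eq_bigr => j _.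
    by rewrite !mxE sym_e; case: (e i j); rewrite ?mulr1 ?mulr0.
  apply/eqP => /rowP/(_ (Ordinal n_gt0)); rewrite !mxE => E.
  by have := z_gt0 (Ordinal n_gt0); rewrite E ltxx.
move=> a /(eigenvalue_subvector sym_e) [x [x_ge0 _ [u xu] ax]].
have zx_gt0 : 0 < \sum_v z v * x v.
  rewrite (bigD1 u) //= xu mulr1 ltr_pwDl // sumr_ge0 // => v _.
  by rewrite mulr_ge0 // ltW.
rewrite -(ler_pM2r zx_gt0) !mulr_sumr.
have -> : \sum_v rho * (z v * x v) = \sum_v z v * (\sum_(w | e v w) x w).
  by rewrite sum_nbr_exchange //; apply: eq_bigr => v _; rewrite ez mulrA.
by apply: ler_sum => v _; rewrite mulrCA ler_wpM2l // ltW.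
Qed.

Lemma sum_class (R : nmodType) (T : finType) (L P : {set T}) (z : T -> R) (a b c : R) :
  [disjoint P & L] -> (forall v, z v = if v \in L then a else if v \in P then c else b) ->
  \sum_v z v = a *+ #|L| + c *+ #|P| + b *+ (#|T| - #|L| - #|P|).
Proof.
move=> dis zE; rewrite (bigID (mem L)) /= (bigID (mem P) (fun v => v \notin L)) /= addrA.
congr (_ + _ + _).
- by rewrite (eq_bigr (fun=> a)) ?sumr_const // => v vL; rewrite zE vL.
- rewrite (eq_bigr (fun=> c)) => [|v /andP[/negbTE vL vP]]; last by rewrite zE vL vP.
  rewrite sumr_const; congr (_ *+ _); apply: eq_card => v; rewrite unfold_in /=.
  by case: (boolP (v \in P)) => vP; rewrite ?andbF // (disjointFr dis vP).
- rewrite (eq_bigr (fun=> b)) => [|v /andP[/negbTE vL /negbTE vP]]; last by rewrite zE vL vP.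
  rewrite sumr_const; congr (_ *+ _).
  have -> : (#|T| - #|L| - #|P| = #|~: (L :|: P)|)%N.
    have := cardsC (L :|: P); have := cardsUI L P.
    by have /eqP -> : L :&: P == set0 by [rewrite setI_eq0 disjoint_sym]; rewrite cards0; lia.
  by apply: eq_card => v; rewrite unfold_in /= !inE negb_or.
Qed.

(** The values on [P] and on the rest solve their own rows of the eigenvalue equation; the condition
    on [rho] is the row of a vertex of [L]. *)
Lemma join_graph_perron (R : realFieldType) (T : finType) (L P : {set T}) (rho : R) (z : T -> R) :
  [disjoint P & L] -> (#|P| == 0)%N || (#|P| == 2)%N -> (0 < #|L|)%N -> 1 < rho ->
  rho = #|L|.-1%:R + (#|T| - #|L| - #|P|)%:R * (#|L|%:R / rho) + #|P|%:R * (#|L|%:R / (rho - 1)) ->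
  (forall v, z v = if v \in L then 1 else if v \in P then #|L|%:R / (rho - 1) else #|L|%:R / rho) ->
  forall v, \sum_(w | join_graph L P v w) z w = rho * z v.
Proof.
move=> dis cardP L_gt0 rho_gt1 rhoE zE v.
have rho0 : rho != 0 by lra.
have rho1 : rho - 1 != 0 by lra.
(* A vertex of [L] sees everything but itself, so its row is this total minus its own entry [1]. *)
have total : \sum_w z w = rho + 1.
  rewrite (sum_class dis zE) -(mulr_natl (_ / (rho - 1))) -(mulr_natl (_ / rho)).
  move: rhoE; move: (_ / (rho - 1)) (_ / rho) => g b rhoE.
  have -> : #|L|%:R = #|L|.-1%:R + 1 :> R by rewrite natr1 prednK.
  rewrite [in RHS]rhoE; ring.
have sumL : \sum_(w in L) z w = #|L|%:R.
  by rewrite (eq_bigr (fun=> 1)) ?sumr_const // => w wL; rewrite zE wL.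
case: (boolP (v \in L)) => vL.
  rewrite zE vL mulr1; apply: (addrI (z v)); rewrite [in RHS]zE vL addrC.
  rewrite addrC [RHS]addrC -total [RHS](bigD1 v) //=; congr (_ + _); apply: eq_bigl => w.
  by rewrite /join_graph vL andbT eq_sym.
case: (boolP (v \in P)) => vP.
  have P2 : #|P| = 2%N.
    by case/orP: cardP => /eqP // P0; have := card0_eq P0 v; rewrite vP.
  rewrite zE (negbTE vL) vP (bigID (mem L)) /=.
  rewrite (eq_bigl (fun w => w \in L)) => [|w]; last first.
    rewrite /join_graph; case: (boolP (w \in L)) => wL; rewrite ?andbF // ?orbT ?andbT //.
    by apply: contraNneq vL => ->.
  rewrite sumL (eq_bigl (fun w => w \in P :\ v)) => [|w]; last first.
    rewrite /join_graph !inE (negbTE vL) vP /= eq_sym.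
    case: (boolP (w \in P)) => wP; first by rewrite (disjointFr dis wP) !andbT.
    by rewrite orbF; case: (w \in L); rewrite ?andbF.
  rewrite (eq_bigr (fun=> #|L|%:R / (rho - 1))) => [|w]; last first.
    by rewrite !inE => /andP[_ wP]; rewrite zE wP (disjointFr dis wP).
  have := cardsD1 v P; rewrite vP P2 sumr_const add1n => -[<-]; rewrite mulr1n; field.
  exact: rho1.
rewrite zE (negbTE vL) (negbTE vP) (eq_bigl (fun w => w \in L)) => [|w].
  by rewrite sumL mulrC divfK.
rewrite /join_graph (negbTE vL) (negbTE vP) /= orbF.
by case: (boolP (w \in L)) => wL; rewrite ?andbF // andbT; apply: contraNneq vL => ->.
Qed.

(** Clearing denominators gives a cubic that changes sign between [2] and [n]; a root there is away
    from the poles [0] and [1]. *)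
Lemma exists_perron_root (R : rcfType) (n h s : nat) :
  (1 < h)%N -> (s <= 2)%N -> (4 * h + 4 <= n)%N ->
  exists2 rho : R, 2 <= rho &
    rho = h.-1%:R + (n - h - s)%:R * (h%:R / rho) + s%:R * (h%:R / (rho - 1)).
Proof.
move=> h_gt1 s_le2 n_big.
pose p : {poly R} := 'X * ('X - 1) * ('X - h.-1%:R%:P)
  - ((n - h - s) * h)%:R%:P * ('X - 1) - (s * h)%:R%:P * 'X.
have pE x : p.[x] = x * (x - 1) * (x - h.-1%:R) - ((n - h - s) * h)%:R * (x - 1) - (s * h)%:R * x.
  by rewrite /p !hornerE.
have hR : h.-1%:R = h%:R - 1 :> R by rewrite -[h in RHS](prednK (ltnW h_gt1)) -natr1 addrK.
have h2 : 2 <= h%:R :> R by rewrite ler_nat.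
have nR : (n - h - s)%:R = n%:R - h%:R - s%:R :> R by rewrite !natrB //; lia.
have nb : 4 * h%:R + 4 <= n%:R :> R by rewrite -natrM -natrD ler_nat.
have s2 : s%:R <= 2 :> R by rewrite ler_nat.
have s0 : 0 <= s%:R :> R by [].
have [||rho] := @poly_ivt R p 2 n%:R; rewrite ?pE; first by lra.
  rewrite !natrM hR nR; apply/andP; split; nra.
move=> /andP[rho2 _] /rootP; rewrite pE => root.
exists rho => //; have [r0 r1] : rho != 0 /\ rho - 1 != 0 by split; lra.
apply/eqP; rewrite -subr_eq0; apply/eqP.
apply: (mulfI (mulf_neq0 r0 r1)); rewrite mulr0 -[RHS]root !natrM; field.
by rewrite r0 r1.
Qed.

(** * Degree sums weighted by a vector *)

Lemma card_nbrI (T : finType) (e : rel T) (a : T) (B : {set T}) :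
  #|nbr e a :&: B| = (\sum_(b in B) e a b)%N.
Proof.
rewrite -sum1_card big_mkcond [RHS]big_mkcond; apply: eq_bigr => b _.
by rewrite !inE; case: (e a b); case: (b \in B).
Qed.

Lemma sum_card_nbr_exchange (T : finType) (e : rel T) (A B : {set T}) : symmetric e ->
  (\sum_(a in A) #|nbr e a :&: B| = \sum_(b in B) #|nbr e b :&: A|)%N.
Proof.
move=> sym_e; under eq_bigr do rewrite card_nbrI.
under [RHS]eq_bigr do rewrite card_nbrI.
by rewrite exchange_big; apply: eq_bigr => b _; apply: eq_bigr => a _; rewrite sym_e.
Qed.

(** Without disjointness: [A :\: B] is handled by the bipartite bound, and [A :&: B] adds at most
    the degree sum inside [B], whence the factor [3 = 1 + 2]. *)
Lemma Ffree_sum_deg_general (T : finType) (e : rel T) (k l : nat) (A B : {set T}) :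
  symmetric e -> (1 < l)%N -> Ffree (kstar_path k l) e ->
  (\sum_(a in A) #|nbr e a :&: B| <= (k + l./2).-1 * #|A| + 3 * (k.+1 * l) * #|B|)%N.
Proof.
move=> sym_e l_gt1 freeG; rewrite (big_setID B) /=.
have disAB : [disjoint A :\: B & B] by rewrite disjoint_sym disjoints_subset subsetC subsetDr.
have := Ffree_bipartite sym_e l_gt1 freeG disAB; have := Ffree_sum_deg B sym_e l_gt1 freeG.
have : (\sum_(a in A :&: B) #|nbr e a :&: B| <= \sum_(a in B) #|nbr e a :&: B|)%N.
  by rewrite [leqRHS](big_setID A) setIC leq_addr.
by have := subset_leq_card (subsetDl A B); nia.
Qed.

Lemma natr_card_nbr (R : pzSemiRingType) (T : finType) (e : rel T) (a : T) (B : {set T}) :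
  #|nbr e a :&: B|%:R = \sum_(w | e a w) (w \in B)%:R :> R.
Proof.
rewrite -sum1_card natr_sum big_mkcond [RHS]big_mkcond; apply: eq_bigr => w _.
by rewrite !inE; case: (e a w); case: (w \in B).
Qed.

(* Layer-cake form of the edge bound: subtracting a multiple of the indicator of the
   support reduces to [Ffree_sum_deg_general]. *)
Lemma Ffree_weighted_sum_deg (R : realFieldType) (T : finType) (e : rel T) (k l : nat)
    (A : {set T}) (y : T -> R) (M : R) :
  symmetric e -> (1 < l)%N -> Ffree (kstar_path k l) e -> 0 <= M ->
  (forall v, 0 <= y v <= M) ->
  \sum_(a in A) \sum_(w | e a w) y w <=
    (k + l./2).-1%:R * M * #|A|%:R + 3 * (k.+1 * l)%:R * \sum_w y w.
Proof.
move=> sym_e l_gt1 freeG; have [m] := ubnP #|[set v | 0 < y v]|.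
elim: m y M => // m IHm y M lt_m M_ge0 y_bd.
set S := [set v | 0 < y v] in lt_m.
have y_out v : v \notin S -> y v = 0.
  by rewrite inE -leNgt => yv; apply/le_anti; rewrite yv; case/andP: (y_bd v).
have [S0|[s0 s0S]] := set_0Vmem S.
  have y0 v : y v = 0 by rewrite y_out // S0 inE.
  rewrite big1 => [|a _]; last by rewrite big1.
  by rewrite addr_ge0 ?mulr_ge0 ?sumr_ge0 // => v _; rewrite y0.
(* Subtracting the least positive value on the support lowers the bound [M] by as much and removes
   [s] from the support, so the induction proceeds. *)
pose s := [arg min_(v < s0 in S) y v]%O.
have [sS s_min] : s \in S /\ forall v, v \in S -> y s <= y v.
  by rewrite /s; case: arg_minP.
have ys_gt0 : 0 < y s by move: sS; rewrite inE.
have ysM : y s <= M by case/andP: (y_bd s).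
pose y' v := y v - y s * (v \in S)%:R.
have y'_bd v : 0 <= y' v <= M - y s.
  rewrite /y'; case: (boolP (v \in S)) => vS.
    by have := s_min v vS; have := y_bd v; rewrite mulr1; lra.
  by rewrite y_out // mulr0; lra.
have supp' : [set v | 0 < y' v] \proper S.
  apply/properP; split.
    apply/subsetP => v; rewrite inE /y'; apply: contraTT => vS.
    by rewrite y_out // (negbTE vS) mulr0 subrr ltxx.
  by exists s => //; rewrite inE /y' sS mulr1 subrr ltxx.
have /IHm : (#|[set v | (0 < y' v)%R]| < m)%N by apply: leq_trans (proper_card supp') _.
have M_ge0' : 0 <= M - y s by lra.
move=> /(_ _ M_ge0' y'_bd) IH.
have base : \sum_(a in A) \sum_(w | e a w) (w \in S)%:R <=
    (k + l./2).-1%:R * #|A|%:R + 3 * (k.+1 * l)%:R * #|S|%:R :> R.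
  under eq_bigr do rewrite -natr_card_nbr.
  rewrite -natr_sum -!natrM -natrD ler_nat.
  exact: Ffree_sum_deg_general.
have yE v : y v = y' v + y s * (v \in S)%:R by rewrite /y' subrK.
have -> : \sum_(a in A) \sum_(w | e a w) y w = \sum_(a in A) \sum_(w | e a w) y' w
    + y s * \sum_(a in A) \sum_(w | e a w) (w \in S)%:R.
  rewrite mulr_sumr -big_split /=; apply: eq_bigr => a _.
  by rewrite mulr_sumr -big_split /=; apply: eq_bigr => w _.
have -> : \sum_w y w = \sum_w y' w + y s * #|S|%:R.
  rewrite -sum1_card natr_sum mulr_sumr [X in _ = _ + X]big_mkcond -big_split /=; apply: eq_bigr => w _.
  by rewrite yE; case: (w \in S); rewrite ?mulr1 ?mulr0.
have := ler_wpM2l (ltW ys_gt0) base; rewrite !natrM; lra.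
Qed.

(** * Vertices with large entries *)

Lemma sum_walk2 (R : pzSemiRingType) (T : finType) (e : rel T) (u : T) (f : T -> R) :
  symmetric e ->
  \sum_(a in nbr e u) \sum_(w | e a w) f w = \sum_w f w * #|nbr e u :&: nbr e w|%:R.
Proof.
move=> sym_e; rewrite (exchange_big_dep xpredT) //=; apply: eq_bigr => w _.
rewrite sumr_const -[LHS]mulr_natr; congr (_ * _%:R); apply: eq_card => a.
by rewrite in_setI unfold_in /= [a \in nbr e w]inE [e w a]sym_e.
Qed.

Lemma card_setC_nbr (T : finType) (e : rel T) (u : T) : #|~: nbr e u| = (#|T| - #|nbr e u|)%N.
Proof. by have := cardsC (nbr e u); lia. Qed.

Lemma card_common_nbr (T : finType) (e : rel T) (u w : T) :
  (#|nbr e u| + #|nbr e w| <= #|T| + #|nbr e u :&: nbr e w|)%N.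
Proof. by rewrite -cardsUI leq_add2r max_card. Qed.

(** One vertex too many would send about [(h + 1) n] edges to its complement, where
    [h = (k + l./2).-1], against the bipartite bound of about [h n]. *)
Lemma few_high_degree (R : realFieldType) (T : finType) (e : rel T) (k l : nat) (eps : R)
    (L : {set T}) :
  symmetric e -> (3 < l)%N -> Ffree (kstar_path k l) e ->
  (16 * (k.+1 * l) ^ 2 < #|T|)%N -> eps * (k.+1 * l)%:R <= 1 / 2 ->
  {in L, forall w, (1 - eps) * #|T|%:R <= #|nbr e w|%:R} -> 0 <= eps ->
  (#|L| <= (k + l./2).-1)%N.
Proof.
move=> sym_e l_gt3 freeG n_big epsN degL eps_ge0; rewrite leqNgt; apply/negP.
move=> /exists_subset_card [B sB cardB].
have l_gt1 : (1 < l)%N by lia.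
have := Ffree_bipartite sym_e l_gt1 freeG (_ : [disjoint ~: B & B]).
have -> : [disjoint ~: B & B] by rewrite disjoints_subset.
move/(_ isT); rewrite sum_card_nbr_exchange // cardB.
have lt_hN : ((k + l./2).-1.+1 <= k.+1 * l)%N by nia.
move: lt_hN cardB n_big epsN; move: (k + l./2).-1 (k.+1 * l)%N => h N lt_hN cardB n_big epsN.
rewrite -(ler_nat R) natrD !natrM natr_sum.
have degB b : b \in B -> (1 - eps) * #|T|%:R - h.+1%:R <= #|nbr e b :&: ~: B|%:R.
  move=> bB; have := degL b (subsetP sB b bB).
  have : (#|nbr e b| <= h.+1 + #|nbr e b :&: ~: B|)%N.
    rewrite -(cardsID B (nbr e b)) setDE leq_add2r -cardB.
    by rewrite subset_leq_card // subsetIr.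
  by rewrite -(ler_nat R) natrD; lra.
have : \sum_(b in B) ((1 - eps) * #|T|%:R - h.+1%:R) <= \sum_(b in B) #|nbr e b :&: ~: B|%:R :> R.
  exact: ler_sum.
rewrite sumr_const cardB -[leLHS]mulr_natr => /le_trans/[apply].
have : #|~: B|%:R <= #|T|%:R :> R by rewrite ler_nat max_card.
have : 16 * N%:R ^+ 2 < #|T|%:R :> R by rewrite -natrX -natrM ltr_nat.
have : h%:R + 1 <= N%:R :> R by rewrite natr1 ler_nat.
have : 0 <= h%:R :> R by [].
have -> : h.+1%:R = h%:R + 1 :> R by rewrite natr1.
move: epsN eps_ge0; move: #|T|%:R #|~: B|%:R h%:R N%:R => n m h' N'.
move=> epsN e0 h0 hN mn nb fin.
have N2 : 0 <= N' ^+ 2 by apply: sqr_ge0.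
have n0 : 0 <= n by lra.
have en : eps * (h' + 1) * n <= 1 / 2 * n.
  by apply: ler_wpM2r => //; apply: le_trans epsN; apply: ler_wpM2l.
have hn : h' * m <= h' * n by rewrite ler_wpM2l.
have hh : (h' + 1) * (N' + (h' + 1)) <= N' * (N' + N').
  by apply: ler_pM; lra.
suff : h' * m + N' * (h' + 1) < ((1 - eps) * n - (h' + 1)) * (h' + 1) by rewrite ltNge fin.
lra.
Qed.

Lemma exists_dominating_set (R : realFieldType) (T : finType) (e : rel T) (k l : nat)
    (x : T -> R) (r : R) (u0 : T) :
  symmetric e -> (3 < l)%N -> (0 < k)%N -> Ffree (kstar_path k l) e ->
  (forall v, 0 <= x v <= 1) -> x u0 = 1 ->
  (forall v, r * x v <= \sum_(w | e v w) x w) ->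
  (k + l./2).-1%:R * #|T|%:R <= r ^+ 2 ->
  1152 * (k.+1 * l)%:R ^+ 2 * ((k.+1 * l)%:R + 1) ^+ 2 <= r ->
  (16 * (k.+1 * l) ^ 2 < #|T|)%N ->
  exists L : {set T}, [/\ #|L| = (k + l./2).-1,
    forall w, w \in L -> 1 / 2 <= x w,
    forall w, w \notin L -> x w * (8 * ((k.+1 * l)%:R + 1)) < 1 &
    forall w, w \in L -> 32 * ((k.+1 * l)%:R + 1) ^+ 2 * #|~: nbr e w|%:R <= #|T|%:R :> R].
Proof.
move=> sym_e l_gt3 k_gt0 freeG x_bd xu0 ex r2 r_big n_big.
have l_gt1 : (1 < l)%N by lia.
set nu := (k.+1 * l)%:R in r_big *.
have nu_ge8 : 8 <= nu by rewrite /nu ler_nat; nia.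
set h := (k + l./2).-1 in r2 *.
have h_ge1 : 1 <= h%:R :> R by rewrite (ler_nat R 1) /h; lia.
have h_le : h%:R <= nu by rewrite /nu ler_nat /h; nia.
have n_gt0 : 0 < #|T|%:R :> R by rewrite ltr0n; apply: leq_ltn_trans n_big.
set n : R := #|T|%:R in r2 n_gt0 *.
have nu2_gt0 : 0 < nu ^+ 2 by apply: exprn_gt0; lra.
have nu12_gt0 : 0 < (nu + 1) ^+ 2 by apply: exprn_gt0; lra.
have r_gt0 : 0 < r by apply: lt_le_trans r_big; apply: mulr_gt0 => //; apply: mulr_gt0.
(* Summing [r x <= A x] bounds [\sum_v x v] by [2 * nu * n / r], so the error term
   [3 * nu * \sum_v x v] of the weighted bound is at most [eps * n]. *)
pose eps := 6 * nu ^+ 2 / r.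
have eps_ge0 : 0 <= eps by rewrite divr_ge0 ?(ltW r_gt0) // mulr_ge0 // ltW.
have eps_r : eps * r = 6 * nu ^+ 2 by rewrite divfK // gt_eqF.
(* The hypothesis on [r] is made for this: [1152 = 6 * 192], and [192 = 6 * 32] gives the claimed
   bound on the non-neighbours of vertices in [L]. *)
have eps_small : 192 * (nu + 1) ^+ 2 * eps <= 1.
  by rewrite /eps mulrA ler_pdivrMr // mul1r; apply: le_trans r_big; nra.
have deg_le v : #|nbr e v|%:R <= n by rewrite ler_nat max_card.
have sum_x : 3 * nu * \sum_v x v <= eps * n.
  have rY : r * \sum_v x v <= 2 * nu * n.
    have degT : \sum_(v in [set: T]) #|nbr e v :&: [set: T]|%:R <= 2 * nu * n.
      rewrite -natr_sum /nu /n -!natrM ler_nat -cardsT.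
      exact: Ffree_sum_deg sym_e l_gt1 freeG.
    apply: le_trans degT; rewrite mulr_sumr big_mkcond [leRHS]big_mkcond; apply: ler_sum => v _.
    rewrite inE natr_card_nbr; apply: le_trans (ex v) _; apply: ler_sum => w _.
    by rewrite inE; case/andP: (x_bd w).
  rewrite -(ler_pM2r r_gt0) (_ : eps * n * r = eps * r * n); last ring.
  rewrite eps_r; nra.
have walk2 v : r ^+ 2 * x v <= \sum_(a in nbr e v) \sum_(w | e a w) x w.
  rewrite (eq_bigl (e v)) => [|a]; last by rewrite inE.
  rewrite expr2 -mulrA; apply: le_trans (ler_wpM2l (ltW r_gt0) (ex v)) _.
  by rewrite mulr_sumr; apply: ler_sum => a _; apply: ex.
have degx v : (x v - eps) * n <= #|nbr e v|%:R.
  have := Ffree_weighted_sum_deg (nbr e v) sym_e l_gt1 freeG ler01 x_bd.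
  move/(le_trans (walk2 v)); rewrite -/h -/nu mulr1 => hv.
  have xv : 0 <= x v by case/andP: (x_bd v).
  have : h%:R * (n * x v) <= r ^+ 2 * x v by rewrite mulrA ler_wpM2r.
  have := deg_le v; move: hv sum_x; move: (\sum_v x v) #|nbr e v|%:R => Y d hv sY dn hn.
  have : h%:R * (n * x v) <= h%:R * d + eps * n by lra.
  have : 0 <= eps * n by rewrite mulr_ge0 // ltW.
  nra.
(* Doubling with truncation at 1 keeps the upper bound on weighted walks from [u0] near [h * n],
   which [x] already attains. Hence [y - x] is small wherever many neighbours are shared with [u0],
   that is, wherever [x] is not small; but [y = x] only at 0 and 1. *)
pose y v := if 2 * x v <= 1 then 2 * x v else 1.
have y_bd v : 0 <= y v <= 1.
  by rewrite /y; case: ifP => [|_]; [have /andP[] := x_bd v; lra|rewrite ler01 lexx].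
have gap_ge0 v : 0 <= y v - x v.
  rewrite /y; case: ifP => [|_]; first by have /andP[] := x_bd v; lra.
  by have /andP[] := x_bd v; lra.
have hn_le : h%:R * n <= \sum_w x w * #|nbr e u0 :&: nbr e w|%:R.
  by rewrite -sum_walk2 //; apply: le_trans (walk2 u0); rewrite xu0 mulr1.
have gap_sum : \sum_w (y w - x w) * #|nbr e u0 :&: nbr e w|%:R <= 2 * eps * n.
  under eq_bigr do rewrite mulrBl.
  rewrite sumrB -sum_walk2 //.
  have := Ffree_weighted_sum_deg (nbr e u0) sym_e l_gt1 freeG ler01 y_bd.
  rewrite -/h -/nu mulr1.
  have : \sum_w y w <= 2 * \sum_w x w.
    rewrite mulr_sumr; apply: ler_sum => w _; rewrite /y; case: ifP => // /negbT.
    by rewrite -ltNge; lra.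
  have := deg_le u0; move: hn_le sum_x.
  move: (\sum_w y w) (\sum_w x w) (\sum_(a in _) _) (\sum_w _) #|nbr e u0|%:R => Y X A B d.
  move=> hB sX dn YX; have : h%:R * d <= h%:R * n by rewrite ler_wpM2l //; lra.
  have : 3 * nu * Y <= 2 * (3 * nu * X) by nra.
  lra.
have common w : (x w - 2 * eps) * n <= #|nbr e u0 :&: nbr e w|%:R.
  have := card_common_nbr e u0 w; rewrite -(ler_nat R) !natrD.
  by have := degx w; have := degx u0; rewrite xu0 -/n; lra.
have gap w : (y w - x w) * (x w - 2 * eps) <= 2 * eps.
  rewrite -(ler_pM2r n_gt0) -mulrA.
  apply: le_trans (ler_wpM2l (gap_ge0 w) (common w)) _; apply: le_trans gap_sum.
  rewrite (bigD1 w) //= lerDl sumr_ge0 // => v _; exact: mulr_ge0.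
pose L := [set w | 1 / 2 <= x w].
have x_out w : w \notin L -> y w - x w = x w.
  by rewrite inE -ltNge /y => xw; rewrite ifT; lra.
have eps_le : eps <= 1 / 1000 by nra.
have x_in w : w \in L -> 1 - x w <= 5 * eps.
  rewrite inE => xw; have := gap w; have /andP[_ x1] := x_bd w.
  by rewrite /y; case: ifP; nra.
have degL w : w \in L -> (1 - 6 * eps) * n <= #|nbr e w|%:R.
  by move=> /x_in xw; apply: le_trans (degx w); rewrite ler_wpM2r ?(ltW n_gt0) //; lra.
exists L; split.
- have eps6_ge0 : 0 <= 6 * eps by rewrite mulr_ge0.
  have eps6_nu : 6 * eps * nu <= 1 / 2.
    have : eps * nu <= eps * (nu + 1) ^+ 2 by rewrite ler_wpM2l //; nra.
    lra.
  apply/eqP; rewrite eqn_leq (few_high_degree sym_e l_gt3 freeG n_big eps6_nu degL eps6_ge0) /=.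
  rewrite -ltnS -(ltr_nat R) -natr1.
  (* Outside [L] one has [y - x = x], so the small total gap also bounds the walks ending there; the
     remaining walks must end in [L], which therefore has at least [h] vertices. *)
  have : h%:R * n <= #|L|%:R * n + 2 * eps * n.
    apply: le_trans hn_le _; rewrite (bigID (mem L)) /= lerD //.
      rewrite mulr_natl -sumr_const; apply: ler_sum => w _.
      have /andP[x0 x1] := x_bd w; apply: le_trans (ler_wpM2r _ x1) _ => //.
      by rewrite mul1r ler_nat max_card.
    apply: le_trans gap_sum; rewrite [leRHS](bigID (mem L)) /= -[leLHS]add0r lerD //.
      by apply: sumr_ge0 => w _; exact: mulr_ge0.
    by apply: ler_sum => w wL; rewrite x_out.
  by rewrite -mulrDl ler_pM2r //; lra.
- by move=> w; rewrite inE.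
- move=> w wL; have := gap w; rewrite (x_out _ wL) ltNge => g; apply/negP => big.
  have eps_q : 2 * eps * (8 * (nu + 1)) <= 1 / 100 by nra.
  have eps_q2 : 2 * eps * (8 * (nu + 1)) ^+ 2 <= 2 / 3 by nra.
  have : x w * (x w - 2 * eps) * (8 * (nu + 1)) ^+ 2 <= 2 * eps * (8 * (nu + 1)) ^+ 2.
    by rewrite ler_wpM2r // exprn_ge0 //; lra.
  move: big eps_q eps_q2; set q := 8 * (nu + 1) => big eps_q eps_q2.
  have -> : x w * (x w - 2 * eps) * q ^+ 2 = x w * q * (x w * q - 2 * eps * q) by ring.
  by move: big eps_q; move: (x w * q) (2 * eps * q) => a b; nra.
- move=> w /degL dw; rewrite card_setC_nbr natrB ?max_card // -/n.
  have : n - #|nbr e w|%:R <= 6 * eps * n by lra.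
  by move: #|nbr e w|%:R => d; nra.
Qed.

(** * Comparison with the extremal graph *)

(** Replacing [h / (rho - 1)] by the smaller [h / rho] gives [rho^2 >= h n + (h - 1) rho - h^2]. The
    order bound forces [rho >= 2 h], and then [(h - 1) rho >= h^2] because [h >= 2]. *)
Lemma perron_root_ge (R : realFieldType) (n h s : nat) (rho : R) :
  (1 < h)%N -> (5 * h + s <= n)%N -> 2 <= rho ->
  rho = h.-1%:R + (n - h - s)%:R * (h%:R / rho) + s%:R * (h%:R / (rho - 1)) ->
  h%:R * n%:R <= rho ^+ 2.
Proof.
move=> h_gt1 n_big rho2 rhoE.
have hR : h.-1%:R = h%:R - 1 :> R by rewrite -[h in RHS](prednK (ltnW h_gt1)) -natr1 addrK.
have h2 : 2 <= h%:R :> R by rewrite ler_nat.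
have nR : (n - h - s)%:R = n%:R - h%:R - s%:R :> R by rewrite !natrB //; lia.
have nb : 5 * h%:R + s%:R <= n%:R :> R by rewrite -natrM -natrD ler_nat.
have s0 : 0 <= s%:R :> R by [].
have rho0 : rho != 0 by lra.
have le_gb : h%:R / rho <= h%:R / (rho - 1) by rewrite ler_wpM2l // lef_pV2 ?posrE; lra.
have b_rho : h%:R / rho * rho = h%:R by rewrite divfK.
have ge1 : h%:R - 1 + (n%:R - h%:R) * (h%:R / rho) <= rho.
  rewrite [leRHS]rhoE hR nR; have := ler_wpM2l s0 le_gb; lra.
have ge2 : (h%:R - 1) * rho + (n%:R - h%:R) * h%:R <= rho ^+ 2.
  have : (h%:R - 1 + (n%:R - h%:R) * (h%:R / rho)) * rho <= rho * rho by rewrite ler_wpM2r //; lra.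
  by rewrite mulrDl -mulrA b_rho expr2.
have ge2h : 2 * h%:R <= rho.
  rewrite -(@ler_pXn2r _ 2) ?nnegrE //; [|by rewrite mulr_ge0|lra].
  apply: le_trans ge2; have : 0 <= (h%:R - 1) * rho by rewrite mulr_ge0; lra.
  have : 4 * h%:R * h%:R <= (n%:R - h%:R) * h%:R :> R by rewrite ler_wpM2r //; lra.
  rewrite exprMn !expr2; lra.
have : (h%:R - 1) * (2 * h%:R) <= (h%:R - 1) * rho by rewrite ler_wpM2l //; lra.
have : 2 * h%:R <= h%:R * h%:R :> R by apply: ler_wpM2r.
lra.
Qed.

Lemma sum_mem_pairs (R : pzSemiRingType) (T : finType) (X : {set T * T}) :
  \sum_v \sum_w ((v, w) \in X)%:R = #|X|%:R :> R.
Proof.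
rewrite pair_bigA /= -sum1_card natr_sum [RHS]big_mkcond; apply: eq_bigr => -[v w] _ /=.
by case: ((v, w) \in X).
Qed.

(* A subvector [x] of [e] is compared with the Perron vector [z] of the target
   graph [J]: the sum of [z v * x w] over pairs present in [J] but not in [e],
   minus that over pairs present in [e] but not in [J], cannot be positive. *)
Lemma perron_comparison (R : realFieldType) (T : finType) (e J : rel T) (x z : T -> R)
    (rho r : R) :
  symmetric J -> rho <= r -> (forall v, 0 <= x v) -> (forall v, 0 <= z v) ->
  (forall v, \sum_(w | J v w) z w = rho * z v) ->
  \sum_v \sum_w z v * x w * ((J v w)%:R - (e v w)%:R)
    + \sum_v z v * (\sum_(w | e v w) x w - r * x v) <= 0.
Proof.
move=> sym_J le_rho x_ge0 z_ge0 Jz.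
have mkc (f : rel T) v : \sum_w z v * x w * (f v w)%:R = z v * \sum_(w | f v w) x w.
  rewrite [X in _ = _ * X]big_mkcond mulr_sumr; apply: eq_bigr => w _.
  by case: (f v w); rewrite ?mulr1 ?mulr0.
have -> : \sum_v \sum_w z v * x w * ((J v w)%:R - (e v w)%:R) =
    \sum_v z v * \sum_(w | J v w) x w - \sum_v z v * \sum_(w | e v w) x w.
  rewrite -sumrB; apply: eq_bigr => v _; rewrite -!mkc -sumrB.
  by apply: eq_bigr => w _; rewrite mulrBr.
have -> : \sum_v z v * (\sum_(w | e v w) x w - r * x v) =
    \sum_v z v * \sum_(w | e v w) x w - r * \sum_v z v * x v.
  by rewrite mulr_sumr -sumrB; apply: eq_bigr => v _; rewrite mulrBr mulrCA.
rewrite sum_nbr_exchange //.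
have -> : \sum_w (\sum_(v | J w v) z v) * x w = rho * \sum_v z v * x v.
  by rewrite mulr_sumr; apply: eq_bigr => w _; rewrite Jz mulrA.
have : 0 <= \sum_v z v * x v by apply: sumr_ge0 => v _; rewrite mulr_ge0.
move: (\sum_v z v * x v) => S S0; have : rho * S <= r * S by rewrite ler_wpM2r.
lra.
Qed.

Local Close Scope ring_scope.
Definition common_nbrs (T : finType) (e : rel T) (L : {set T}) : {set T} :=
  [set v | (v \notin L) && [forall w in L, e v w]].

Lemma notin_common_nbrs (T : finType) (e : rel T) (L : {set T}) (v : T) :
  v \in ~: (L :|: common_nbrs e L) -> exists2 w, w \in L & ~~ e v w.
Proof.
rewrite !inE negb_or => /andP[vL]; rewrite vL /= negb_forall_in.
by move=> /exists_inP.
Qed.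

Lemma leq_card_remainder (N h E t : nat) :
  8 <= N -> h < N -> 16 * N ^ 2 < t -> 32 * (N + 1) * E <= t -> N <= t - h - E.
Proof.
move=> N8 hN Nt Et; have : 32 * E <= 32 * (N + 1) * E by rewrite leq_mul // leq_pmulr // addn1.
have : 8 * N <= N ^ 2 by rewrite -mulnn leq_mul2r N8 orbT.
lia.
Qed.

Local Open Scope ring_scope.

(** A vertex outside [L] and its common neighbourhood is a non-neighbour of some member of [L], so a
    union bound applies. *)
Lemma card_common_nbrs_ge (R : realFieldType) (T : finType) (e : rel T) (L : {set T}) (N : nat) :
  symmetric e -> (8 <= N)%N -> (#|L| < N)%N -> (16 * N ^ 2 < #|T|)%N ->
  (forall w, w \in L -> 32 * (N%:R + 1) ^+ 2 * #|~: nbr e w|%:R <= #|T|%:R :> R) ->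
  (N <= #|common_nbrs e L|)%N.
Proof.
move=> sym_e N8 L_lt n_big degL; pose E := ~: (L :|: common_nbrs e L).
have -> : #|common_nbrs e L| = (#|T| - #|L| - #|E|)%N.
  have := cardsC (L :|: common_nbrs e L); have := cardsUI L (common_nbrs e L).
  have /eqP -> : L :&: common_nbrs e L == set0.
    by rewrite setI_eq0; apply/pred0P => v; rewrite /= inE; case: (v \in L).
  by rewrite cards0 -/E addn0 => -> <-; rewrite -addnA addKn addnK.
apply: leq_card_remainder => //; rewrite -(ler_nat R) !natrM natrD.
have N1 : 0 < N%:R + 1 :> R by rewrite natr1 ltr0n.
have sub : (#|E| <= \sum_(w in L) #|~: nbr e w|)%N.
  apply: leq_trans (leq_card_bigcup _ _); apply/subset_leq_card/subsetP => v.
  move=> /notin_common_nbrs [w wL evw].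
  by apply/bigcupP; exists w => //; rewrite !inE sym_e.
have degE : 32 * (N%:R + 1) ^+ 2 * #|E|%:R <= #|L|%:R * #|T|%:R :> R.
  have -> : #|L|%:R * #|T|%:R = \sum_(w in L) #|T|%:R :> R by rewrite sumr_const mulr_natl.
  apply: le_trans (ler_sum _ degL); rewrite -mulr_sumr; apply: ler_wpM2l.
    by apply: mulr_ge0 => //; apply/exprn_ge0/ltW.
  by rewrite -natr_sum ler_nat.
have LN : #|L|%:R * #|T|%:R <= (N%:R + 1) * #|T|%:R :> R.
  by rewrite ler_wpM2r // natr1 ler_nat ltnW // ltnW.
rewrite -(ler_pM2l N1); apply: le_trans (le_trans degE LN).
by rewrite le_eqVlt; apply/orP; left; apply/eqP; ring.
Qed.

(** Each vertex of [E] gains at least [b / 2] from a missing edge to [L], while each pair of [X]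
    loses at most [3 / 2 * b / q]. As [4 * #|X| <= q * #|E|], the loss is at most
    [3 / 8 * b * #|E|], so a nonempty [E] would make the sum positive. *)
Lemma exceptional_set_empty (R : realFieldType) (T : finType) (e J : rel T)
    (L E : {set T}) (X : {set T * T}) (x z : T -> R) (b q : R) :
  0 < b -> 0 < q -> (forall v, b <= z v) -> (forall v, v \notin L -> z v <= 3 / 2 * b) ->
  (forall v, 0 <= x v) -> (forall w, w \in L -> 1 / 2 <= x w) ->
  (forall w, w \notin L -> x w * q < 1) ->
  (forall v, v \in E -> exists2 w, w \in L & J v w && ~~ e v w) ->
  (forall v w, (v, w) \in X -> (v \notin L) && (w \notin L)) ->
  (forall v w, (v, w) \notin X -> e v w -> J v w) ->
  4 * #|X|%:R <= q * #|E|%:R ->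
  \sum_v \sum_w z v * x w * ((J v w)%:R - (e v w)%:R) <= 0 -> E = set0.
Proof.
move=> b_gt0 q_gt0 z_ge z_le x_ge0 xL xnL EP XP notX cardX sumD_le0.
have z_ge0 v : 0 <= z v by apply: le_trans (z_ge v); apply: ltW.
pose D v w := z v * x w * ((J v w)%:R - (e v w)%:R).
pose c := 3 / 2 * b / q.
have D_X v w : - (c * ((v, w) \in X)%:R) <= D v w.
  case: (boolP ((v, w) \in X)) => [/XP /andP[vL wL]|/notX eJ].
    have xw : x w <= q^-1 by rewrite -[leRHS]mul1r ler_pdivlMr // ltW // xnL.
    apply: (@le_trans _ _ (- (z v * x w))).
      by rewrite lerN2 mulr1; apply: ler_pM => //; apply: z_le.
    rewrite /D -[leLHS]mulrN1 ler_wpM2l ?mulr_ge0 //.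
    by case: (J v w); case: (e v w) => /=; lra.
  rewrite mulr0 oppr0 /D mulr_ge0 ?mulr_ge0 // subr_ge0.
  by case: (e v w) eJ => [->|_].
(* One missing edge is selected per vertex of [E], so the gain can be charged to pairs and bounded
   termwise. *)
pose om v := [pick w in L | J v w && ~~ e v w].
pose m v w := b / 2 * ((v \in E) && (om v == Some w))%:R.
have D_ge v w : m v w - c * ((v, w) \in X)%:R <= D v w.
  case: (boolP ((v \in E) && (om v == Some w))) => [/andP[vE]|no]; last first.
    by rewrite /m (negbTE no) mulr0 sub0r D_X.
  rewrite /m vE /om; case: pickP => [w' /and3P[w'L Jvw' evw'] /eqP[<-]|_ //].
  have -> : ((v, w') \in X) = false by apply/negP => /XP; rewrite w'L andbF.
  rewrite eqxx mulr0 subr0 /D Jvw' (negbTE evw') subr0 !mulr1.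
  by apply: ler_pM (z_ge v) _; rewrite ?(ltW b_gt0) ?invr_ge0 //; have := xL _ w'L; rewrite mul1r.
have sum_m : \sum_v \sum_w m v w = b / 2 * #|E|%:R.
  rewrite -sum1_card natr_sum mulr_sumr [RHS]big_mkcond; apply: eq_bigr => v _.
  rewrite /m; case: (boolP (v \in E)) => vE /=; last by rewrite big1 // => w _; rewrite mulr0.
  have [w omw] : exists w, om v = Some w.
    rewrite /om; case: pickP => [w _|no]; first by exists w.
    by have [w wL evw] := EP v vE; have := no w; rewrite /= wL evw.
  rewrite (bigD1 w) //= omw eqxx big1 ?addr0 // => w' w'w.
  by rewrite (_ : (Some w == Some w') = (w == w')) // eq_sym (negbTE w'w) mulr0.
have sumD : b / 2 * #|E|%:R - c * #|X|%:R <= \sum_v \sum_w D v w.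
  rewrite -sum_m -sum_mem_pairs mulr_sumr -sumrB; apply: ler_sum => v _.
  by rewrite mulr_sumr -sumrB; apply: ler_sum => w _.
have {sumD}sumD := le_trans sumD sumD_le0.
have cX : c * #|X|%:R <= 3 / 8 * b * #|E|%:R.
  have -> : c * #|X|%:R = 3 / 8 * b * (4 * #|X|%:R / q) by rewrite /c; field; lra.
  apply: ler_wpM2l; first by rewrite mulr_ge0 ?(ltW b_gt0) ?divr_ge0.
  by rewrite ler_pdivrMr // [_ * q]mulrC.
have bE : b * #|E|%:R <= 0 :> R by move: (#|E|%:R) (c * _) sumD cX => E' X'; lra.
by apply/eqP; rewrite -cards_eq0 -leqn0 -(ler_nat R) -(pmulr_rle0 _ b_gt0).
Qed.

(** For a subgraph of [J] all terms of the comparison are nonnegative, hence all vanish. *)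
Lemma subgraph_comparison (R : realFieldType) (T : finType) (e J : rel T) (x z : T -> R) (r : R) :
  (forall v, 0 < z v) -> (forall v, 0 <= x v) -> subrel e J ->
  (forall v, r * x v <= \sum_(w | e v w) x w) ->
  \sum_v \sum_w z v * x w * ((J v w)%:R - (e v w)%:R)
    + \sum_v z v * (\sum_(w | e v w) x w - r * x v) <= 0 ->
  (forall v w, J v w -> ~~ e v w -> x w = 0) /\ forall v, \sum_(w | e v w) x w = r * x v.
Proof.
move=> z_gt0 x_ge0 eJ ex.
have slack_ge0 v : 0 <= z v * (\sum_(w | e v w) x w - r * x v).
  by rewrite mulr_ge0 ?subr_ge0 // ltW.
have D_ge0 v w : 0 <= z v * x w * ((J v w)%:R - (e v w)%:R).
  rewrite mulr_ge0 ?mulr_ge0 ?(ltW (z_gt0 v)) // subr_ge0.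
  by case: (boolP (e v w)) => [/eJ ->|_].
have D_ge0' v : 0 <= \sum_w z v * x w * ((J v w)%:R - (e v w)%:R) by apply: sumr_ge0.
move=> tot; have : \sum_v \sum_w z v * x w * ((J v w)%:R - (e v w)%:R)
    + \sum_v z v * (\sum_(w | e v w) x w - r * x v) = 0.
  by apply/le_anti; rewrite tot addr_ge0 ?sumr_ge0.
move/eqP; rewrite paddr_eq0 ?sumr_ge0 // => /andP[/eqP D0 /eqP slack0]; split=> [v w Jvw evw|v].
  have Dv0 : \sum_w z v * x w * ((J v w)%:R - (e v w)%:R) = 0 by apply: (psumr_eq0P _ D0).
  have /eqP : z v * x w * ((J v w)%:R - (e v w)%:R) = 0 by apply: (psumr_eq0P _ Dv0).
  by rewrite Jvw (negbTE evw) subr0 mulr1 mulf_eq0 gt_eqF //= => /eqP.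
have /eqP : z v * (\sum_(w | e v w) x w - r * x v) = 0 by apply: (psumr_eq0P _ slack0).
by rewrite mulf_eq0 subr_eq0 gt_eqF //= => /eqP.
Qed.

Lemma perron_weight_bounds (R : realFieldType) (h rho : R) :
  0 < h -> 3 <= rho ->
  [/\ 0 < h / rho, h / rho <= h / (rho - 1) & h / (rho - 1) <= 3 / 2 * (h / rho)].
Proof.
move=> h_gt0 rho3; split; first by rewrite divr_gt0 //; lra.
  by rewrite ler_wpM2l ?(ltW h_gt0) // lef_pV2 ?posrE; lra.
rewrite ler_pdivrMr; last by lra.
have -> : 3 / 2 * (h / rho) * (rho - 1) = (3 / 2) * (rho - 1) / rho * h by field; lra.
by rewrite -[leLHS]mul1r ler_wpM2r ?(ltW h_gt0) // ler_pdivlMr; lra.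
Qed.

Lemma extremal_structure (R : realFieldType) (T : finType) (e : rel T) (k l : nat)
    (x : T -> R) (r rho : R) (u0 : T) :
  let h := (k + l./2).-1 in let s := (odd l).*2 in let N := (k.+1 * l)%N in
  simple_graph e -> (3 < l)%N -> (0 < k)%N -> Ffree (kstar_path k l) e ->
  (forall v, 0 <= x v) -> (forall v, x v <= 1) -> x u0 = 1 ->
  (forall v, r * x v <= \sum_(w | e v w) x w) ->
  (16 * N ^ 2 < #|T|)%N -> 2 <= rho -> 1152 * N%:R ^+ 2 * (N%:R + 1) ^+ 2 <= rho ->
  rho = h.-1%:R + (#|T| - h - s)%:R * (h%:R / rho) + s%:R * (h%:R / (rho - 1)) ->
  rho <= r ->
  exists L P : {set T}, [/\ #|L| = h, #|P| = s, [disjoint P & L] & e =2 join_graph L P].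
Proof.
move=> h s N [sym_e irr_e] l_gt3 k_gt0 freeG x_ge0 x_le1 xu0 ex n_big rho2 rho_big rhoE le_rho.
have N_ge8 : (8 <= N)%N by rewrite /N; nia.
have h_gt1 : (1 < h)%N by rewrite /h; lia.
have h_leN : (h < N)%N by rewrite /h /N; nia.
have s_le2 : (s <= 2)%N by rewrite /s; case: (odd l).
have n_ge : (5 * h + s <= #|T|)%N.
  have : (8 * N <= N ^ 2)%N by rewrite -mulnn leq_mul2r N_ge8 orbT.
  by lia.
have nu8 : 8 <= N%:R :> R by rewrite (ler_nat R 8).
have rho_sq := perron_root_ge h_gt1 n_ge rho2 rhoE.
have r_sq : h%:R * #|T|%:R <= r ^+ 2.
  by apply: le_trans rho_sq _; rewrite ler_pXn2r // ?nnegrE; lra.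
have x_bd v : 0 <= x v <= 1 by rewrite x_ge0 x_le1.
have [L [cardL xL xnL degL]] := exists_dominating_set sym_e l_gt3 k_gt0 freeG x_bd xu0 ex
  r_sq (le_trans rho_big le_rho) n_big.
pose Rs := common_nbrs e L.
pose E := ~: (L :|: Rs).
have disRL : [disjoint Rs & L].
  by apply/pred0P => v; rewrite /= inE; case: (v \in L); rewrite ?andbF.
have RL : {in Rs & L, forall a w, e a w}.
  by move=> a w; rewrite inE => /andP[_ /forall_inP] /[apply].
have cardR : (k.+1 * l <= #|Rs|)%N.
  by apply: card_common_nbrs_ge degL; rewrite ?cardL.
have EP v : v \in E -> exists2 w, w \in L & ~~ e v w := @notin_common_nbrs T e L v.
have [P [cardP disPL cardX]] :=
  Ffree_few_extra_edges sym_e irr_e l_gt3 freeG cardL cardR disRL RL.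
set X := [set u | _] in cardX; rewrite -/E -/N in cardX.
exists L, P; split=> //.
pose J := join_graph L P; have [sym_J irr_J] : simple_graph J := join_graph_simple L P.
pose b : R := h%:R / rho; pose g : R := h%:R / (rho - 1).
pose z v : R := if v \in L then 1 else if v \in P then g else b.
have h_gt0 : 0 < h%:R :> R by rewrite ltr0n ltnW.
have h_rho : h%:R + 2 <= rho.
  apply: le_trans rho_big; have hN : h%:R + 1 <= N%:R :> R by rewrite natr1 ler_nat.
  have := exprn_ege1 2 (_ : 1 <= N%:R :> R); have := exprn_ege1 2 (_ : 1 <= N%:R + 1 :> R).
  clear -hN nu8; move=> /(_ ltac:(lra)) p2 /(_ ltac:(lra)) p1.
  have : N%:R <= N%:R ^+ 2 :> R by rewrite expr2; nra.
  by move: p1 p2; move: (N%:R ^+ 2) ((N%:R + 1) ^+ 2) => A B; nra.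
have rho3 : 3 <= rho by apply: le_trans h_rho; rewrite -natrD (ler_nat R 3) addn2 !ltnS ltnW.
have rho_gt1 : 1 < rho by apply: lt_le_trans rho2; rewrite ltr1n.
have [b_gt0 b_le_g g_le] := perron_weight_bounds h_gt0 rho3.
rewrite -/b -/g in b_gt0 b_le_g g_le.
have b_le1 : b <= 1.
  by rewrite ler_pdivrMr ?mul1r ?(lt_trans ltr01) //; apply: le_trans h_rho; rewrite lerDl.
have z_ge v : b <= z v by rewrite /z; case: ifP => // _; case: ifP.
have z_gt0 v : 0 < z v := lt_le_trans b_gt0 (z_ge v).
have z_le v : v \notin L -> z v <= 3 / 2 * b.
  move=> vL; rewrite /z (negbTE vL); case: ifP => // _.
  by rewrite -[leLHS]mul1r ler_wpM2r ?(ltW b_gt0) // ler_pdivlMr // mul1r ler_nat.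
have Jz v : \sum_(w | J v w) z w = rho * z v.
  apply: join_graph_perron => //; rewrite ?cardL ?cardP //; first by case: (odd l).
  exact: ltnW.
have master := perron_comparison e sym_J le_rho x_ge0 (fun v => ltW (z_gt0 v)) Jz.
have notX v w : (v, w) \notin X -> e v w -> J v w.
  rewrite inE /= => + evw; rewrite evw /J /join_graph /=.
  have -> /= : v != w by apply/eqP => E'; rewrite E' irr_e in evw.
  by case: (v \in L); case: (w \in L) => //=; rewrite negbK.
have E0 : E = set0.
  (* The value [8 * (N + 1)] is four times the factor [2 * N + 2] bounding the extra edges, and is
     the reciprocal bound on entries outside [L]. *)
  apply: (@exceptional_set_empty R T e J L E X x z b (8 * (N%:R + 1))) => //.
  - by rewrite mulr_gt0 // natr1 ltr0n.
  - move=> v vE; have [w wL evw] := EP v vE; exists w => //; rewrite evw andbT.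
    rewrite /J /join_graph wL orbT andbT.
    by apply: contraTneq vE => ->; rewrite !inE wL.
  - by move=> v w; rewrite inE => /and4P[_ -> ->].
  - have -> : 8 * (N%:R + 1) = 4 * (2 * N + 2)%:R :> R by rewrite natrD natrM; ring.
    by rewrite -mulrA ler_pM2l // -natrM ler_nat.
  - apply: le_trans master; rewrite lerDl sumr_ge0 // => v _.
    by rewrite mulr_ge0 ?(ltW (z_gt0 v)) // subr_ge0.
have X0 : X = set0.
  by apply/eqP; rewrite -cards_eq0 -leqn0 (leq_trans cardX) // E0 cards0 muln0.
have eJ : subrel e J by move=> v w; apply: notX; rewrite X0 inE.
have [miss x_eig] := subgraph_comparison z_gt0 x_ge0 eJ ex master.
move=> v w; apply/idP/idP => [/eJ //|Jvw]; apply: contraT => evw.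
(* With [E] empty, [w] is joined to all of [L]; a zero entry at [w] contradicts the eigenvalue
   equation there, since entries on [L] are positive. *)
have xw0 := miss v w Jvw evw.
have L_gt0 u : u \in L -> 0 < x u by move/xL; apply: lt_le_trans; rewrite divr_gt0.
have wL : w \notin L by apply/negP => /L_gt0; rewrite xw0 ltxx.
have [w' w'L] : exists w', w' \in L by apply/card_gt0P; rewrite cardL ltnW.
have wR : w \in Rs.
  by move/setP/(_ w): E0; rewrite in_set0 in_setC in_setU (negbTE wL) /= => /negbFE.
have := x_eig w; rewrite xw0 mulr0 (bigD1 w') /=; last exact: RL.
by move/eqP; rewrite gt_eqF // ltr_pwDl ?L_gt0 ?sumr_ge0.
Qed.

Lemma join_graph_spec_radius (R : realType) (n : nat) (L P : {set 'I_n}) (e : rel 'I_n) (rho : R) :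
  [disjoint P & L] -> (#|P| == 0)%N || (#|P| == 2)%N -> (0 < #|L|)%N -> 1 < rho ->
  rho = #|L|.-1%:R + (n - #|L| - #|P|)%:R * (#|L|%:R / rho) + #|P|%:R * (#|L|%:R / (rho - 1)) ->
  e =2 join_graph L P -> is_spec_radius e rho.
Proof.
move=> dis cardP L_gt0 rho_gt1 rhoE eJ.
pose z v : R :=
  if v \in L then 1 else if v \in P then #|L|%:R / (rho - 1) else #|L|%:R / rho.
have n_gt0 : (0 < n)%N by rewrite -[n]card_ord (leq_trans L_gt0) ?max_card.
have L0 : 0 < #|L|%:R :> R by rewrite ltr0n.
have [sym_J _] := join_graph_simple L P.
apply: (@perron_spec_radius R n e z) => // [v w|v|v].
- by rewrite !eJ.
- by rewrite /z; case: ifP => // _; case: ifP => _; rewrite divr_gt0 //; lra.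
- rewrite (eq_bigl (join_graph L P v)) => [|w]; last exact: eJ.
  by apply: join_graph_perron; rewrite ?card_ord.
Qed.

(* Numerical thresholds and the characterisation of the extremal graphs *)
Local Close Scope ring_scope.

Lemma size_arith (k l n : nat) :
  let h := (k + l./2).-1 in let N := (k.+1 * l) in
  3 < l -> 0 < k -> 16 * N ^ 2 < n ->
  [/\ 8 <= N, 1 < h, h < N, (odd l).*2 <= 2 & 5 * h + 4 <= n].
Proof.
move=> h N l_gt3 k_gt0 n_big.
have N_ge8 : 8 <= N by rewrite /N; nia.
have h_leN : h < N by rewrite /h /N; nia.
split=> //; [rewrite /h; lia|by case: (odd l)|].
have : 8 * N <= N ^ 2 by rewrite -mulnn leq_mul2r N_ge8 orbT.
lia.
Qed.

(** With [N = k.+1 * l], the parameter [t] is at least [3 * N] and [k + l %/ 2 >= 3]; the constant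
    is [216 = 8 * 3 ^ 3]. *)
Lemma order_bound (k l n : nat) : 0 < k -> 3 < l ->
  8 * (k + l %/ 2) ^ 3 * ((l ^ 2 - l + 1) * k + (l ^ 2 + 3 * l - 2) %/ 2) ^ 8 <= n ->
  216 * (3 * (k.+1 * l)) ^ 8 <= n.
Proof.
move=> k_ge1 l_ge4 n_big; set N := (k.+1 * l).
have h3 : 3 <= k + l %/ 2 by lia.
have tN : 3 * N <= (l ^ 2 - l + 1) * k + (l ^ 2 + 3 * l - 2) %/ 2.
  have t1 : 3 * l * k <= (l ^ 2 - l + 1) * k by rewrite leq_mul2r; apply/orP; right; nia.
  have t2 : 3 * l <= (l ^ 2 + 3 * l - 2) %/ 2 by rewrite leq_divRL //; nia.
  by rewrite /N; lia.
apply: leq_trans n_big; rewrite leq_mul ?leq_exp2r //.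
by apply: (@leq_trans (8 * 3 ^ 3)) => //; rewrite leq_mul2l leq_exp2r.
Qed.

Local Open Scope ring_scope.

(** Squaring turns the claim into a comparison of eighth powers of [N], matching the exponent in the
    order bound; [N >= 8] allows [N + 1 <= 9 / 8 * N]. *)
Lemma perron_root_big (R : realFieldType) (h N n : nat) (rho : R) :
  (8 <= N)%N -> (1 < h)%N -> (216 * (3 * N) ^ 8 <= n)%N -> 0 <= rho ->
  h%:R * n%:R <= rho ^+ 2 -> 1152 * N%:R ^+ 2 * (N%:R + 1) ^+ 2 <= rho.
Proof.
move=> N8 h2 n_big rho_ge0 rho_sq; have nu8 : 8 <= N%:R :> R by rewrite (ler_nat R 8).
have {}n_big : 216 * (3 * N%:R) ^+ 8 <= n%:R :> R by rewrite -!natrM -natrX -natrM ler_nat.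
have {}h2 : 2 <= h%:R :> R by rewrite (ler_nat R 2).
rewrite -(@ler_pXn2r _ 2) ?nnegrE //; last first.
  by rewrite mulr_ge0 ?mulr_ge0 ?exprn_ge0 //; lra.
apply: le_trans rho_sq; apply: (@le_trans _ _ (2 * n%:R)); last by rewrite ler_wpM2r.
have N1 : (N%:R + 1) ^+ 4 <= (9 / 8 * N%:R) ^+ 4 :> R.
  by rewrite lerXn2r ?nnegrE; lra.
apply: (@le_trans _ _ (1152 ^+ 2 * N%:R ^+ 4 * (9 / 8 * N%:R) ^+ 4)).
  have -> : (1152 * N%:R ^+ 2 * (N%:R + 1) ^+ 2) ^+ 2 =
    1152 ^+ 2 * N%:R ^+ 4 * (N%:R + 1) ^+ 4 :> R by ring.
  rewrite ler_wpM2l //.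
  by rewrite mulr_ge0 ?exprn_ge0.
have -> : 1152 ^+ 2 * N%:R ^+ 4 * (9 / 8 * N%:R) ^+ 4 = (1152 ^+ 2 * (9 / 8) ^+ 4) * N%:R ^+ 8 :> R by ring.
have : 0 <= N%:R ^+ 8 :> R by rewrite exprn_ge0.
rewrite exprMn in n_big; move: (N%:R ^+ 8) n_big => p; lra.
Qed.

(** All the target graphs share the spectral radius [rho], and an [F]-free graph whose spectral
    radius is at least [rho] is one of them; both directions follow. *)
Lemma in_Ex_sp_join_graph (R : realType) (k l n : nat) (e : rel 'I_n) :
  (3 < l)%N -> (0 < k)%N -> (216 * (3 * (k.+1 * l)) ^ 8 <= n)%N ->
  (16 * (k.+1 * l) ^ 2 < n)%N ->
  in_Ex_sp R (kstar_path k l) e <->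
  exists L P : {set 'I_n}, [/\ #|L| = (k + l./2).-1, #|P| = (odd l).*2, [disjoint P & L] &
    e =2 join_graph L P].
Proof.
move=> l_gt3 k_gt0 n_big8 n_big.
have [N_ge8 h_gt1 h_leN s_le2 n_ge] := size_arith l_gt3 k_gt0 n_big.
set h := (k + l./2).-1 in h_gt1 h_leN n_ge *.
have n_ge1 : (4 * h + 4 <= n)%N by apply: leq_trans n_ge; rewrite leq_add2r leq_mul2r orbT.
have n_ge2 : (5 * h + (odd l).*2 <= n)%N.
  by apply: leq_trans n_ge; rewrite leq_add2l (leq_trans s_le2).
have [rho rho2 rhoE] := exists_perron_root R h_gt1 s_le2 n_ge1.
have rho_ge0 : 0 <= rho by apply: le_trans rho2.
have rho_gt1 : 1 < rho by apply: lt_le_trans rho2; rewrite ltr1n.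
have rho_big := perron_root_big N_ge8 h_gt1 n_big8 rho_ge0 (perron_root_ge h_gt1 n_ge2 rho2 rhoE).
have radius (L P : {set 'I_n}) f : #|L| = h -> #|P| = (odd l).*2 -> [disjoint P & L] ->
    f =2 join_graph L P -> is_spec_radius f rho.
  move=> cardL cardP dis; apply: join_graph_spec_radius; rewrite ?cardL ?cardP //.
    by case: (odd l).
  exact: ltnW.
have simpleJ (L P : {set 'I_n}) f : f =2 join_graph L P -> simple_graph f.
  move=> fJ; have [sym_J irr_J] := join_graph_simple L P.
  by split=> [x y|x]; rewrite !fJ.
have freeJ (L P : {set 'I_n}) f : #|L| = h -> #|P| = (odd l).*2 -> f =2 join_graph L P ->
    Ffree (kstar_path k l) f.
  move=> cardL cardP fJ [g [inj_g gE]].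
  have lt_h : (#|L| < k + l./2)%N by rewrite cardL /h prednK // addn_gt0 k_gt0.
  by apply: (join_graph_Ffree l_gt3 lt_h cardP); exists g; split=> // x y /gE; rewrite fJ.
have structure f r : simple_graph f -> Ffree (kstar_path k l) f -> is_spec_radius f r ->
    rho <= r -> exists L P : {set 'I_n}, [/\ #|L| = h, #|P| = (odd l).*2, [disjoint P & L] &
    f =2 join_graph L P].
  move=> simple_f free_f [eig_r _] le_rho.
  have [x [x_ge0 x_le1 [u xu] fx]] := eigenvalue_subvector (proj1 simple_f) eig_r.
  by apply: (extremal_structure (rho := rho) _ _ _ _ _ _ xu fx) => //; rewrite ?card_ord.
split=> [[simple_e [free_e [rG [radG maxG]]]]|[L [P [cardL cardP dis eJ]]]].
  apply: structure radG _ => //.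
  (* A concrete target graph is a competitor, which forces [rho <= rG]. *)
  pose L0 := [set x : 'I_n | (0 <= x < 0 + h)%N].
  pose P0 := [set x : 'I_n | (h <= x < h + (odd l).*2)%N].
  have cardL0 : #|L0| = h.
    by apply: card_ord_interval; rewrite (leq_trans _ n_ge2) // (leq_trans _ (leq_addr _ _)) // leq_pmull.
  have cardP0 : #|P0| = (odd l).*2.
    by apply: card_ord_interval; rewrite (leq_trans _ n_ge2) // leq_add2r leq_pmull.
  have dis0 : [disjoint P0 & L0].
    by apply/pred0P => x /=; rewrite !inE add0n; case: (ltnP x h); rewrite ?andbF.
  have J0 : join_graph L0 P0 =2 join_graph L0 P0 by [].
  by apply: (maxG _ (simpleJ _ _ _ J0) (freeJ _ _ _ cardL0 cardP0 J0)); apply: radius J0.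
split; first exact: simpleJ eJ.
split; first exact: freeJ eJ.
exists rho; split=> [|eH simple_H free_H rH radH]; first exact: radius eJ.
(* A competitor beating [rho] would itself be a target graph, hence have spectral radius [rho]. *)
rewrite leNgt; apply/negP => lt_rho.
have [L' [P' [cardL' cardP' dis' HJ]]] := structure _ _ simple_H free_H radH (ltW lt_rho).
have [_ /(_ _ (proj1 radH))] := radius _ _ _ cardL' cardP' dis' HJ.
by rewrite leNgt lt_rho.
Qed.

Lemma graph_iso_join_graph (n h s : nat) (e : rel 'I_n) (L0 P0 : {set 'I_n}) :
  #|L0| = h -> #|P0| = s -> [disjoint P0 & L0] ->
  graph_iso e (join_graph L0 P0) <->
  exists L P : {set 'I_n}, [/\ #|L| = h, #|P| = s, [disjoint P & L] & e =2 join_graph L P].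
Proof.
move=> cardL0 cardP0 dis0; split=> [|[L [P [cardL cardP dis eJ]]]].
  by case/graph_iso_join => // L [P [cardL cardP dis eJ]]; exists L, P; rewrite cardL cardP.
have eqL : #|L| = #|L0| by rewrite cardL.
have eqP : #|P| = #|P0| by rewrite cardP.
have [f [bij_f fE]] := join_graph_iso eqL eqP dis dis0.
by exists f; split=> // x y; rewrite eJ.
Qed.

Local Close Scope ring_scope.

Theorem theorem1p12 (R : realType) (k l n : nat) :
  (1 <= k)%N -> (4 <= l)%N ->
  let t := ((l ^ 2 - l + 1) * k + (l ^ 2 + 3 * l - 2) %/ 2)%N in
  (8 * (k + l %/ 2) ^ 3 * t ^ 8 <= n)%N ->
  (~~ odd l -> forall e : rel 'I_n,
      in_Ex_sp R (kstar_path k l) e <->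
      graph_iso e (S_nh n ((2 * k + l - 2) %/ 2))) /\
  (odd l -> forall e : rel 'I_n,
      in_Ex_sp R (kstar_path k l) e <->
      graph_iso e (S_nh_plus n ((2 * k + l - 3) %/ 2))).
Proof.
move=> k_ge1 l_ge4 t /(order_bound k_ge1 l_ge4) n_big8.
have n_big : 16 * (k.+1 * l) ^ 2 < n.
  have N0 : 0 < k.+1 * l by rewrite muln_gt0 (ltn_trans _ l_ge4).
  apply: leq_trans n_big8; apply: (@leq_trans (216 * (k.+1 * l) ^ 2)).
    by rewrite ltn_mul2r expn_gt0 N0.
  rewrite leq_mul2l /=; apply: leq_trans (leq_pexp2l _ (_ : 2 <= 8)) => //.
    by rewrite leq_exp2r // leq_pmull.
  by rewrite muln_gt0.
have [_ _ _ _ n_ge] := size_arith l_ge4 k_ge1 n_big.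
have half_l := odd_double_half l.
have iso_ext (e f g : rel 'I_n) : f =2 g -> graph_iso e f <-> graph_iso e g.
  by move=> fg; split=> -[p [bij_p ep]]; exists p; split=> // x y; rewrite ep fg.
set h := (k + l./2).-1 in n_ge.
have cardL0 : #|[set x : 'I_n | 0 <= x < 0 + h]| = h.
  by apply: card_ord_interval; clear -n_ge; lia.
split=> [evl|oddl] e.
  have -> : (2 * k + l - 2) %/ 2 = h.
    by rewrite /h; clear -evl half_l k_ge1; rewrite (negbTE evl) in half_l; lia.
  apply: iff_trans (iff_sym (iso_ext _ _ _ (S_nh_join_graph h))).
  apply: iff_trans (in_Ex_sp_join_graph R e l_ge4 k_ge1 n_big8 n_big) _.
  rewrite (negbTE evl); apply: iff_sym; apply: graph_iso_join_graph; rewrite ?cards0 //.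
  by rewrite disjoints_subset sub0set.
have -> : (2 * k + l - 3) %/ 2 = h.
  by rewrite /h; clear -oddl half_l k_ge1 l_ge4; rewrite oddl in half_l; lia.
apply: iff_trans (iff_sym (iso_ext _ _ _ (S_nh_plus_join_graph h))).
apply: iff_trans (in_Ex_sp_join_graph R e l_ge4 k_ge1 n_big8 n_big) _.
rewrite oddl; apply: iff_sym; apply: graph_iso_join_graph => //.
  by apply: card_ord_interval; clear -n_ge; lia.
by apply/pred0P => x /=; rewrite !inE add0n; case: (ltnP x h); rewrite ?andbF.
Qed.
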